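(* Let $\phi$ be a conjugate linear involution of a conformal vertex algebra $V$, let $g(a)=e^{-\pi\sqrt{-1}(\Delta_a+\frac12 p(a))}\phi(a)$, and let $A(z)v=e^{zL_1}z^{-2L_0}g(v)$, $v\in V$. Let $\Gamma$ be an additive subgroup of $\mathbb R$ containing $\mathbb Z$, let $\Upsilon$ be a $\Gamma/\mathbb Z$-grading on $V$ compatible with $\phi$ (i.e. $\phi(V^{[\gamma]})\subseteq V^{[\gamma]}$ for all $\gamma\in\Gamma$), and let $M=\bigoplus_{n\ge0}M_n$ be an $\Upsilon$-twisted positive energy $V$-module. Let $M^\dagger=\bigoplus_{n\ge 0}M_n^\dagger$ be its restricted conjugate dual. Then: (a) The map $Y_{M^\dagger}$ given by $$\langle Y_{M^\dagger}(v,z)m',m\rangle=\langle m',Y_M(A(z)v,z^{-1})m\rangle,\qquad v\in V,\ m\in M,\ m'\in M^\dagger,$$ defines on $M^\dagger$ the structure of a $(-\Upsilon)$-twisted $V$-module. (b) If $\dim M_n<\infty$ for all $n$, then $(M^\dagger)^\dagger$ is naturally isomorphic to $M$.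
   Context: Base field $\mathbb C$. A vertex algebra is a vector superspace $V=V_{\bar0}\oplus V_{\bar1}$ with state-field correspondence $Y(a,z)=\sum_{n\in\mathbb Z}a_{(n)}z^{-n-1}$, vacuum $\mathbf 1$ and translation operator $T$ (i.e. a vertex superalgebra). $p(a)\in\{0,1\}\subset\mathbb Z$ is the parity, $p(a,b)=(-1)^{p(a)p(b)}$. Conformal vertex algebra: there is a distinguished vector $L\in V_2$ with $Y(L,z)=\sum_n L_nz^{-n-2}$, $[L_m,L_n]=(m-n)L_{m+n}+\frac1{12}(m^3-m)\delta_{m+n,0}\,c\,I$, $L_{-1}=T$, $L_0$ diagonalizable with eigenspace decomposition $V=\bigoplus_{n\in\frac12\mathbb Z_{\ge0}}V_n$, $\dim V_n<\infty$, $V_0=\mathbb C\mathbf 1$. $\Delta_a$ is the $L_0$-eigenvalue (conformal weight) of $a\in V_{\Delta_a}$. A conjugate linear involution of $V$ is a parity preserving conjugate linear map $\phi:V\to V$ with $\phi^2=I$, $\phi(u_{(n)}v)=\phi(u)_{(n)}\phi(v)$ for all $n\in\mathbb Z$, and $\phi(L)=L$. A $\Gamma/\mathbb Z$-grading $\Upsilon:[\gamma]\mapsto V^{[\gamma]}$ is a decomposition $V=\bigoplus_{[\gamma]\in\Gamma/\mathbb Z}V^{[\gamma]}$ with $V^{[\alpha]}{}_{(n)}V^{[\beta]}\subseteq V^{[\alpha+\beta]}$ and $L_0V^{[\gamma]}\subseteq V^{[\gamma]}$; here $[\gamma]=\gamma+\mathbb Z$. The opposite grading $-\Upsilon$ is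 $(-\Upsilon)([\gamma])=\Upsilon(-[\gamma])$. An $\Upsilon$-twisted $V$-module is a vector superspace $M$ with a parity preserving linear map $a\mapsto Y_M(a,z)=\sum_{m\in[\gamma]}a^M_{(m)}z^{-m-1}$ for $a\in V^{[\gamma]}$ ($a^M_{(m)}\in\mathrm{End}\,M$, $a^M_{(m)}v=0$ for each $v\in M$ and $m\gg0$) such that $\mathbf 1^M_{(n)}=\delta_{n,-1}I_M$ and, for $a\in V^{[\gamma_a]}$, $b\in V^{[\gamma_b]}$, $m\in[\gamma_a]$, $n\in\mathbb Z$, $k\in[\gamma_b]$, $v\in M$, $$\sum_{j\ge0}\binom mj(a_{(n+j)}b)^M_{(m+k-j)}v=\sum_{j\ge0}(-1)^j\binom nj\big(a^M_{(m+n-j)}b^M_{(k+j)}-p(a,b)(-1)^nb^M_{(k+n-j)}a^M_{(m+j)}\big)v .$$ For $a\in V^{[\gamma]}_{\Delta_a}$ one also writes $Y_M(a,z)=\sum_{n\in[\gamma-\Delta_a]}a^M_nz^{-n-\Delta_a}$. $M$ is a positive energy module if it has an $\mathbb R$-grading $M=\bigoplus_{j\ge0}M_j$ with $a^M_nM_j\subseteq M_{j-n}$. $M_n^\dagger$ is the space of conjugate linear maps $M_n\to\mathbb C$, and $\langle m',m\rangle=m'(m)$ denotes the pairing of $M^\dagger$ with $M$ (linear in $m'$, conjugate linear in $m$).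
   Formalization: The formal theorem adds the hypothesis that L lies in V^{[0]} (equivalently, that L_1, not only L_0, preserves each V^{[γ]}); without it (a) fails, e.g. for the Heisenberg algebra with L = ½α_{-1}²1 + λα_{-2}1, λ ≠ 0 real, graded by α → −α. *)

(* Defs.v *)
From HB Require Import structures.
From mathcomp Require Import all_boot all_order all_algebra.
From mathcomp Require Import complex.
From mathcomp Require Import all_classical all_reals all_analysis.

Set Implicit Arguments.
Unset Strict Implicit.
Unset Printing Implicit Defensive.

Import Order.TTheory GRing.Theory Num.Theory.

Local Open Scope classical_set_scope.
Local Open Scope complex_scope.
Local Open Scope ring_scope.

(* The base field is [R[i]], the complex numbers over a model [R] of the reals.
   Sums [\sum_(i \in A) _] are sums of finitely supported families. *)

Section LinearAlgebra.
Variable R : realType.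
Implicit Types U W : lmodType R[i].

Definition subspace U (F : set U) : Prop :=
  F 0 /\ forall (c : R[i]) u v, F u -> F v -> F (c *: u + v).

Definition conj_linear U W (f : U -> W) : Prop :=
  forall (c : R[i]) u v, f (c *: u + v) = c^* *: f u + f v.

Definition finite_dim U (F : set U) : Prop :=
  exists (n : nat) (b : 'I_n -> U), (forall i, F (b i)) /\
    forall v, F v -> exists c : 'I_n -> R[i], v = \sum_(i < n) c i *: b i.

Definition decomposes U (I : choiceType) (D : set I) (F : I -> set U)
    (v : U) (x : I -> U) : Prop :=
  [/\ forall i, D i -> F i (x i),
      forall i, ~ D i -> x i = 0,
      finite_set [set i | x i != 0] &
      v = \sum_(i \in [set: I]) x i].

(* U is the internal direct sum of the subspaces [F i], i \in D *)
Definition direct_sum U (I : choiceType) (D : set I) (F : I -> set U) : Prop :=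
  (forall i, D i -> subspace (F i)) /\
  (forall v, exists! x, decomposes D F v x).

Definition component U (I : choiceType) (D : set I) (F : I -> set U)
    (v : U) : I -> U :=
  xget (fun=> 0) (decomposes D F v).

(* [F] is a subspace of the superspace [(U, par)] in the graded sense, i.e.
   the sum of its intersections with the even and odd parts; [par false] is
   the even part and [par true] the odd part *)
Definition super_subspace U (par : bool -> set U) (F : set U) : Prop :=
  subspace F /\
  forall v, F v -> exists v0 v1,
    [/\ par false v0, par true v1, F v0, F v1 & v = v0 + v1].

End LinearAlgebra.

Section VertexAlgebras.
Variable R : realType.
Local Notation C := R[i].

Definition gbinom (x : C) (j : nat) : C :=
  (\prod_(i < j) (x - i%:R)) / (j`!)%:R.

(* The Borcherds identity at (a, b, m, n, k, v) for an action of the modes of V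
   on M, where modes are indexed by K (the integers for V itself, the reals
   for twisted modules) and [p], [q] are the parities of [a], [b].  *)
Definition borcherds (V M : lmodType C) (K : pzRingType) (emb : K -> C)
    (mul : V -> int -> V -> V) (act : V -> K -> M -> M)
    (p q : bool) (a b : V) (m : K) (n : int) (k : K) (v : M) : Prop :=
  \sum_(j \in [set: nat])
     gbinom (emb m) j *: act (mul a (n + j%:Z) b) (m + k - j%:R) v
  = \sum_(j \in [set: nat])
     ((-1) ^+ j * gbinom n%:~R j) *:
       (act a (m + n%:~R - j%:R) (act b (k + j%:R) v)
        - ((-1) ^+ (p && q) * (-1) ^ n) *:
            act b (k + n%:~R - j%:R) (act a (m + j%:R) v)).

(* [nprod a n b] is a_(n) b. The translation operator is recovered as
   T a = a_(-2) 1, see [translation] below. *)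
Record vertexAlgebra := VertexAlgebra {
  va_car :> lmodType C;
  parity : bool -> set va_car;
  nprod : va_car -> int -> va_car -> va_car;
  vac : va_car;
  parity_direct : direct_sum [set: bool] parity;
  nprod_linearl : forall n b, linear (fun a => nprod a n b);
  nprod_linearr : forall a n, linear (nprod a n);
  nprod_parity : forall p q a b n,
    parity p a -> parity q b -> parity (p (+) q) (nprod a n b);
  nprod_field : forall a b, exists N : int,
    forall n, N <= n -> nprod a n b = 0;
  vac_even : parity false vac;
  vac_nprod : forall a n, nprod vac n a = (if n == -1 then a else 0);
  nprod_vac : forall a n, -1 <= n ->
    nprod a n vac = (if n == -1 then a else 0);
  va_borcherds : forall p q a b m n k v, parity p a -> parity q b ->
    borcherds (fun m : int => m%:~R) nprod nprod p q a b m n k v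
}.

Definition translation (V : vertexAlgebra) (a : V) : V := nprod a (-2) (vac V).

(* L_n, the coefficient of z^(-n-2) in Y(L, z) *)
Definition virasoro (V : vertexAlgebra) (L : V) (n : int) (v : V) : V :=
  nprod L (n + 1) v.

(* V_(k/2), the space of vectors of conformal weight k/2 *)
Definition weight_space (V : vertexAlgebra) (L : V) (k : nat) : set V :=
  [set v | virasoro L 0 v = (k%:R / 2) *: v].

Record conformalVertexAlgebra := ConformalVertexAlgebra {
  cva_va :> vertexAlgebra;
  cvec : cva_va;
  central_charge : C;
  cvec_even : parity false cvec;
  cvec_weight : weight_space cvec 4 cvec;
  virasoro_rel : forall (m n : int) (v : cva_va),
    virasoro cvec m (virasoro cvec n v) - virasoro cvec n (virasoro cvec m v)
    = (m - n)%:~R *: virasoro cvec (m + n) v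
      + ((m ^+ 3 - m)%:~R / 12 * (m + n == 0)%:R * central_charge) *: v;
  virasoro_translation : forall v, virasoro cvec (-1) v = translation v;
  weight_direct : direct_sum [set: nat] (weight_space cvec);
  weight_finite_dim : forall k, finite_dim (weight_space cvec k);
  weight0 : forall v, weight_space cvec 0 v <-> exists c : C, v = c *: vac cva_va
}.

Definition Lop (V : conformalVertexAlgebra) (n : int) : V -> V :=
  virasoro (cvec V) n.

Definition weight (V : conformalVertexAlgebra) : nat -> set V :=
  weight_space (cvec V).

Record conj_involution (V : conformalVertexAlgebra) (phi : V -> V) : Prop :=
  ConjInvolution {
    phi_conj_linear : conj_linear phi;
    phi_parity : forall p v, parity p v -> parity p (phi v);
    phi_invol : forall v, phi (phi v) = v;
    phi_nprod : forall u n v, phi (nprod u n v) = nprod (phi u) n (phi v);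
    phi_cvec : phi (cvec V) = cvec V
  }.

Section Opposite.
Variables (V : conformalVertexAlgebra) (phi : V -> V).

Definition expi (t : R) : C := cos t +i* sin t.

Definition weight_component (v : V) (k : nat) : V :=
  component [set: nat] (@weight V) v k.

Definition parity_component (v : V) (p : bool) : V :=
  component [set: bool] (@parity V) v p.

(* The additive extension of
     g(a) = e^(- pi sqrt(-1) (Delta_a + p(a)/2)) phi(a),
   for a of conformal weight Delta_a = k/2 and parity p *)
Definition gmap (v : V) : V :=
  \sum_(k \in [set: nat]) \sum_(p : bool)
    expi (- (pi * (k%:R / 2 + p%:R / 2))) *:
      phi (parity_component (weight_component v k) p).

(* The coefficient of z^i in z^(-2 L_0) u *)
Definition zpow_m2L0 (u : V) (i : int) : V :=
  if i is Posz n.+1 then 0 else weight_component u `|i|%N.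

(* The coefficient of z^i in e^(z L_1) f(z) *)
Definition exp_zL1 (f : int -> V) (i : int) : V :=
  \sum_(j \in [set: nat]) ((j`!)%:R^-1 : C) *: iter j (@Lop V 1) (f (i - j%:Z)).

(* The coefficient of z^i in A(z) v = e^(z L_1) z^(-2 L_0) g(v) *)
Definition Acoef (v : V) (i : int) : V := exp_zL1 (zpow_m2L0 (gmap v)) i.

End Opposite.

Definition subgroup_with_Z (Gamma : set R) : Prop :=
  (forall n : int, Gamma n%:~R) /\
  (forall x y, Gamma x -> Gamma y -> Gamma (x - y)).

(* [gamma] = gamma + Z *)
Definition Zcoset (gamma : R) : set R :=
  [set gamma + n%:~R | n in [set: int]].

(* Gamma/Z-gradings: V^[gamma] is [Ups (Zcoset gamma)] *)
Record graded_mod_Z (V : conformalVertexAlgebra) (Gamma : set R)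
    (Ups : set R -> set V) : Prop := GradedModZ {
  Ups_super : forall gamma, Gamma gamma ->
    super_subspace (@parity V) (Ups (Zcoset gamma));
  Ups_direct : direct_sum (Zcoset @` Gamma) Ups;
  Ups_nprod : forall alpha beta a n b, Gamma alpha -> Gamma beta ->
    Ups (Zcoset alpha) a -> Ups (Zcoset beta) b ->
    Ups (Zcoset (alpha + beta)) (nprod a n b);
  Ups_L0 : forall gamma v, Gamma gamma ->
    Ups (Zcoset gamma) v -> Ups (Zcoset gamma) (Lop 0 v)
}.

Definition opp_grading (V : conformalVertexAlgebra) (Ups : set R -> set V) :
    set R -> set V :=
  fun X => Ups [set - x | x in X].

(* [Y a m] is a^M_(m). The index m runs over all reals: for a in V^[gamma]
   only the modes with m in [gamma] may be nonzero, and a general a acts by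
   the sum of the modes of its V^[gamma]-components. *)
Record twisted_module (V : conformalVertexAlgebra) (Gamma : set R)
    (Ups : set R -> set V) (M : lmodType C) (parM : bool -> set M)
    (Y : V -> R -> M -> M) : Prop := TwistedModule {
  tm_parity_direct : direct_sum [set: bool] parM;
  tm_linearl : forall m v, linear (fun a => Y a m v);
  tm_linearr : forall a m, linear (Y a m);
  tm_modes : forall gamma a m v, Gamma gamma -> Ups (Zcoset gamma) a ->
    ~ Zcoset gamma m -> Y a m v = 0;
  tm_parity : forall p q a m v,
    parity p a -> parM q v -> parM (p (+) q) (Y a m v);
  tm_field : forall a v, exists N : R, forall m, N <= m -> Y a m v = 0;
  tm_vac : forall m v, Y (vac V) m v = (if m == -1 then v else 0);
  tm_borcherds : forall p q ga gb a b m n k v,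
    Gamma ga -> Gamma gb -> Ups (Zcoset ga) a -> Ups (Zcoset gb) b ->
    parity p a -> parity q b -> Zcoset ga m -> Zcoset gb k ->
    borcherds (fun x : R => x%:C) (@nprod V) Y p q a b m n k v
}.

(* Positive energy gradings: for a of conformal weight Delta, the operator
   a^M_n is a^M_(n + Delta - 1). *)
Record positive_energy (V : conformalVertexAlgebra) (Gamma : set R)
    (Ups : set R -> set V) (M : lmodType C) (parM : bool -> set M)
    (Y : V -> R -> M -> M) (grM : R -> set M) : Prop := PositiveEnergy {
  pe_super : forall j, super_subspace parM (grM j);
  pe_direct : direct_sum [set: R] grM;
  pe_pos : forall j v, j < 0 -> grM j v -> v = 0;
  pe_modes : forall gamma k a n j v, Gamma gamma ->
    Ups (Zcoset gamma) a -> weight k a -> Zcoset (gamma - k%:R / 2) n ->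
    grM j v -> grM (j - n) (Y a (n + k%:R / 2 - 1) v)
}.

End VertexAlgebras.

Section RestrictedDual.
Variables (R : realType) (M : lmodType R[i]) (grM : R -> set M).
Local Notation C := R[i].

(* The direct sum of the spaces M_n^dagger: a finite family of conjugate linear
   functionals on the M_n is the same as a conjugate linear functional on M
   vanishing on all but finitely many M_n. *)
Definition rdual_pred : {pred M -> C^o} := fun f =>
  `[< conj_linear f /\
      finite_set [set n | exists2 m, grM n m & f m <> 0] >].

Fact rdual_submod_closed : submod_closed rdual_pred.
Proof.
split.
  apply/asboolP; split; first by move=> c u v /=; rewrite scaler0 addr0.
  by rewrite (_ : mkset _ = set0) // -subset0 => n [m _]; case.
move=> a f g /asboolP[fl ff] /asboolP[gl gf]; apply/asboolP; split.
  move=> c u v; change (a *: f (c *: u + v) + g (c *: u + v) =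
    c^* *: (a *: f u + g u) + (a *: f v + g v)).
  rewrite fl gl !scalerDr !scalerA [a * _]mulrC -!addrA.
  by congr (_ + _); rewrite addrCA.
have fin : finite_set ([set n | exists2 m, grM n m & f m <> 0] `|`
                       [set n | exists2 m, grM n m & g m <> 0]).
  by rewrite finite_setU.
apply: sub_finite_set fin => n [m mn] afg0.
have [fm0|fm0] := pselect (f m = 0); last by left; exists m.
right; exists m => // gm0; apply: afg0.
by change (a *: f m + g m = 0); rewrite fm0 gm0 scaler0 addr0.
Qed.

HB.instance Definition _ :=
  GRing.isSubmodClosed.Build C (M -> C^o) rdual_pred rdual_submod_closed.

Record rdual := RDual {
  pairing :> M -> C^o;
  _ : pairing \in rdual_pred
}.

HB.instance Definition _ := [isSub for pairing].
HB.instance Definition _ := [Choice of rdual by <:].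
HB.instance Definition _ := [SubChoice_isSubLmodule of rdual by <:].

(* (M^dagger)_n is M_n^dagger *)
Definition rdual_gr (n : R) : set rdual :=
  [set f | forall j m, j <> n -> grM j m -> f m = 0].

Definition rdual_par (parM : bool -> set M) (p : bool) : set rdual :=
  [set f | forall m, parM (~~ p) m -> f m = 0].

End RestrictedDual.

Section Contragredient.
Variables (R : realType) (V : conformalVertexAlgebra R) (phi : V -> V).
Variables (M : lmodType R[i]) (Y : V -> R -> M -> M).

(* The coefficient of z^(-n-1) in Y_M(A(z) v, z^(-1)) m: the coefficient
   A_i v of z^i contributes its mode of index l with i + l + 1 = - n - 1 *)
Definition opp_mode (v : V) (n : R) (m : M) : M :=
  \sum_(i \in [set: int]) Y (Acoef phi v i) (- n - 2 - i%:~R) m.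

(* <Y^dagger(v, z) m', m> = <m', Y(A(z) v, z^(-1)) m> *)
Definition contragredient (grM : R -> set M)
    (Yd : V -> R -> rdual grM -> rdual grM) : Prop :=
  forall v n (m' : rdual grM) m, Yd v n m' m = m' (opp_mode v n m).

End Contragredient.

Record graded_module_iso (R : realType) (V : conformalVertexAlgebra R)
    (M N : lmodType R[i])
    (parM : bool -> set M) (grM : R -> set M) (YM : V -> R -> M -> M)
    (parN : bool -> set N) (grN : R -> set N) (YN : V -> R -> N -> N)
    (h : M -> N) : Prop := GradedModuleIso {
  iso_linear : linear h;
  iso_bij : bijective h;
  iso_parity : forall p m, parM p m <-> parN p (h m);
  iso_gr : forall j m, grM j m <-> grN j (h m);
  iso_action : forall v n m, h (YM v n m) = YN v n (h m)
}.

(* Main.v *)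
Require Import Defs.
From mathcomp Require Import all_boot all_order all_algebra.
From mathcomp Require Import complex.
From mathcomp Require Import ring lra zify.
From mathcomp Require Import all_classical all_reals all_analysis.

Set Implicit Arguments.
Unset Strict Implicit.
Unset Printing Implicit Defensive.

Import Order.TTheory GRing.Theory Num.Theory.

Local Open Scope classical_set_scope.
Local Open Scope complex_scope.
Local Open Scope ring_scope.

(** Everything happens on [M]. Write [L1div s] for L_1^s / s!. For [v] of weight
    k/2 the opposite modes of [v] are finite sums of modes of the vectors
    L1div s (g v) with scalar coefficients, and L_1 acts on products by
      L1div s (a_(n) b) = sum_(u + r + t = s)
        binom(k - 2 - n - u, r) (L1div u a)_(n + r) (L1div t b).
    Substituting this in the left side of the Borcherds identity for the opposite
    modes, the identity sum_j (-1)^j binom(m, j) binom(x - j, q - j) = binom(x - m, q)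
    turns it into a sum over (u, t) of left sides of Borcherds identities of [M]
    for L1div u (g a) and L1div t (g b), at the indices k_a - 2 - m - n - u and
    k_b - 2 - k - n - t; the right sides match as well. Pairing with a functional
    gives (a). For (b), g^2 = 1 and g L_1 = - L_1 g show that taking opposite
    modes twice gives back the original modes. *)

(** Working on M means that sums are finite for another reason than on the dual. On x in M the inner
    opposite mode vanishes once its index is very negative, while on M^dagger the positivity of the
    energy kills the modes of large index. The identity on M is therefore stated for all
    sufficiently long partial sums: such statements add up over a and b, and fit any truncation on
    M^dagger. The phase in g is made for g(a_(n) b) = - (-1)^(p(a) p(b)) (-1)^n g(a)_(n) g(b).
    Multiplying the right side of the Borcherds identity by this sign exchanges its two terms, which
    is the reversal of order that pairing with a functional requires. The indices m and k are real,
    so only binomial identities valid for arbitrary upper argument can be used. The hypothesis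
    [hUpsL] keeps L_1 inside each V^[gamma], so that the identities of M apply to all L1div u (g
    a). *)

(** * Finitely supported sums *)

Section FiniteSupport.
Variable W : nmodType.

Lemma fsum_seq (T : choiceType) (r : seq T) (f : T -> W) : uniq r ->
  (forall i, i \notin r -> f i = 0) ->
  \sum_(i \in [set: T]) f i = \sum_(i <- r) f i.
Proof.
move=> ur f0; rewrite (fsbigE r) //; last by move=> i _; exact: f0.
by apply: eq_bigl => i; rewrite in_setT.
Qed.

Lemma fsum_nat (N : nat) (f : nat -> W) : (forall i, (N <= i)%N -> f i = 0) ->
  \sum_(i \in [set: nat]) f i = \sum_(i < N) f i.
Proof.
move=> f0; rewrite (@fsum_seq _ (iota 0 N)) ?iota_uniq //.
  by rewrite -(big_mkord xpredT) /index_iota subn0.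
by move=> i; rewrite mem_iota /= add0n -leqNgt; exact: f0.
Qed.

Lemma sum_nat_widen (N K : nat) (f : nat -> W) : (N <= K)%N ->
  (forall i, (N <= i)%N -> f i = 0) -> \sum_(i < N) f i = \sum_(i < K) f i.
Proof.
move=> NK f0; rewrite -(fsum_nat f0) (@fsum_nat K) // => i Ki.
by apply: f0; exact: leq_trans Ki.
Qed.

Definition int_range (N : nat) : seq int :=
  [seq i%:Z - N%:Z | i <- iota 0 (N + N)].

Lemma int_range_uniq N : uniq (int_range N).
Proof. by rewrite map_inj_uniq ?iota_uniq // => i j /addIr[]. Qed.

Lemma mem_int_range N (i : int) : (`|i| < N)%N -> i \in int_range N.
Proof.
move=> iN; apply/mapP; exists `|(i + N%:Z)%R|%N; last by lia.
by rewrite mem_iota; lia.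
Qed.

Lemma fsum_int (N : nat) (f : int -> W) :
  (forall i, (N <= `|i|)%N -> f i = 0) ->
  \sum_(i \in [set: int]) f i = \sum_(i <- int_range N) f i.
Proof.
move=> f0; apply: fsum_seq; first exact: int_range_uniq.
move=> i iN; apply: f0; rewrite leqNgt; apply: contra iN.
exact: mem_int_range.
Qed.

(** Serves the induction in [L1div_nprod]: L_1 raises one summation index, and the raised sum is
    brought back to the same range because both boundary terms vanish. *)
Lemma shift_sum (N : nat) (A B : nat -> W) : (forall u, B u.+1 = A u) ->
  B 0%N = 0 -> A N = 0 -> \sum_(u < N.+1) A u = \sum_(u < N.+1) B u.
Proof.
move=> BA B0 AN; rewrite big_ord_recr /= AN addr0 big_ord_recl B0 add0r.
by apply: eq_bigr => i _; rewrite -BA.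
Qed.

Lemma sum_nat_pick (N i : nat) (f : nat -> W) : (i < N)%N ->
  (forall j, j != i -> f j = 0) -> \sum_(j < N) f j = f i.
Proof.
move=> iN f0; rewrite (bigD1 (Ordinal iN)) //= big1 ?addr0 // => j ji.
by apply: f0; apply: contra ji => /eqP ji; apply/eqP/val_inj.
Qed.

End FiniteSupport.

(** * Subspaces and components in direct sums *)

Section Subspaces.
Variables (R : realType) (U : lmodType R[i]) (F : set U).
Hypothesis sF : Defs.subspace F.

Lemma subspace0 : F 0. Proof. by case: sF. Qed.

Lemma subspaceZD c u v : F u -> F v -> F (c *: u + v).
Proof. exact: (proj2 sF). Qed.

Lemma subspaceD u v : F u -> F v -> F (u + v).
Proof. by move=> Fu Fv; rewrite -[u]scale1r; exact: subspaceZD. Qed.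

Lemma subspaceZ c u : F u -> F (c *: u).
Proof.
by move=> Fu; rewrite -[_ *: _]addr0; apply: subspaceZD => //; exact: subspace0.
Qed.

Lemma subspaceB u v : F u -> F v -> F (u - v).
Proof. by move=> Fu Fv; rewrite addrC -scaleN1r; exact: subspaceZD. Qed.

Lemma subspace_sum (J : Type) (r : seq J) (P : pred J) (f : J -> U) :
  (forall j, P j -> F (f j)) -> F (\sum_(j <- r | P j) f j).
Proof. by move=> Ff; elim/big_ind: _ => //; [exact: subspace0|exact: subspaceD]. Qed.

End Subspaces.

Section DirectSums.
Variables (R : realType) (U : lmodType R[i]) (I : choiceType).
Variables (D : set I) (F : I -> set U).
Hypothesis ds : direct_sum D F.

Local Notation cmp := (component D F).

Lemma ds_subspace i : D i -> Defs.subspace (F i).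
Proof. exact: (proj1 ds). Qed.

Lemma componentP v : decomposes D F v (cmp v).
Proof.
case: ds => _ /(_ v)[x [xP _]].
by rewrite /component; apply: (xgetPex (fun=> 0)); exists x.
Qed.

Lemma component_unique v x : decomposes D F v x -> x = cmp v.
Proof.
move=> xP; case: ds => _ /(_ v)[y [_ yU]].
by rewrite -(yU _ xP); apply: yU; exact: componentP.
Qed.

Lemma component_mem v i : D i -> F i (cmp v i).
Proof. by move=> Di; case: (componentP v) => vF _ _ _; exact: vF. Qed.

Lemma component_out v i : ~ D i -> cmp v i = 0.
Proof. by move=> Di; case: (componentP v) => _ vF _ _; exact: vF. Qed.

Lemma component_support v :
  exists2 r, uniq r & forall i, i \notin r -> cmp v i = 0.
Proof.
case: (componentP v) => _ _ /finite_seqP[r rE] _; exists (undup r).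
  exact: undup_uniq.
move=> i; rewrite mem_undup => ir; apply/eqP; apply: contraNT ir => vi.
by have : [set` r] i by rewrite -rE.
Qed.

Lemma component_sum v r : uniq r -> (forall i, i \notin r -> cmp v i = 0) ->
  v = \sum_(i <- r) cmp v i.
Proof.
by move=> ur r0; case: (componentP v) => _ _ _ {1}->; exact: fsum_seq.
Qed.

Lemma component_eq v r x : uniq r -> (forall i, D i -> F i (x i)) ->
  (forall i, ~ D i -> x i = 0) -> (forall i, i \notin r -> x i = 0) ->
  v = \sum_(i <- r) x i -> forall i, cmp v i = x i.
Proof.
move=> ur xF xD xr vE i; rewrite -(@component_unique v x) //; split=> //.
  apply: (@sub_finite_set _ _ [set` r]); last exact: finite_seq.
  by move=> j /=; apply: contraNT => /xr ->.
by rewrite vE (fsum_seq ur).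
Qed.

Lemma componentZD c u v i : cmp (c *: u + v) i = c *: cmp u i + cmp v i.
Proof.
have [r ur r0] := component_support u; have [s us s0] := component_support v.
pose t := undup (r ++ s).
have tr j : j \notin t -> j \notin r.
  by apply: contraNN; rewrite mem_undup mem_cat => ->.
have tS j : j \notin t -> j \notin s.
  by apply: contraNN; rewrite mem_undup mem_cat orbC => ->.
apply: (@component_eq _ t (fun i => c *: cmp u i + cmp v i)).
- exact: undup_uniq.
- move=> j Dj; apply: subspaceZD; first exact: ds_subspace.
    exact: component_mem.
  exact: component_mem.
- by move=> j Dj; rewrite !component_out // scaler0 addr0.
- by move=> j jt; rewrite r0 ?s0 ?scaler0 ?addr0 //; [exact: tS|exact: tr].
rewrite big_split /= -scaler_sumr -!component_sum //; try exact: undup_uniq.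
- by move=> j /tS /s0.
- by move=> j /tr /r0.
Qed.

Lemma component0 i : cmp 0 i = 0.
Proof.
by have := componentZD (-1) 0 0 i; rewrite scaler0 addr0 scaleN1r addNr.
Qed.

Lemma componentD u v i : cmp (u + v) i = cmp u i + cmp v i.
Proof. by have := componentZD 1 u v i; rewrite !scale1r. Qed.

Lemma componentZ c u i : cmp (c *: u) i = c *: cmp u i.
Proof. by have := componentZD c u 0 i; rewrite !addr0 component0 addr0. Qed.

Lemma component_hom v i : D i -> F i v ->
  forall j, cmp v j = if j == i then v else 0.
Proof.
move=> Di Fv; apply: (@component_eq _ [:: i]) => //.
- move=> j Dj; case: eqP => [->//|_]; by apply: subspace0; exact: ds_subspace.
- by move=> j Dj; case: eqP => // ji; case: Dj; rewrite ji.
- by move=> j; rewrite inE => /negbTE ->.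
- by rewrite big_seq1 eqxx.
Qed.

Lemma component_id v i : D i -> F i v -> cmp v i = v.
Proof. by move=> Di Fv; rewrite (component_hom Di Fv) eqxx. Qed.

Lemma component_neq v i j : D i -> F i v -> j != i -> cmp v j = 0.
Proof. by move=> Di Fv ji; rewrite (component_hom Di Fv) (negbTE ji). Qed.

Lemma component_inj u v : (forall i, cmp u i = cmp v i) -> u = v.
Proof.
move=> uv; have [r ur r0] := component_support u.
rewrite (component_sum ur r0) [RHS](@component_sum _ r) //.
- by apply: eq_bigr.
- by move=> i /r0; rewrite uv.
Qed.

(** Reduces additive properties to homogeneous vectors; applied to V, to M, and to the dual and
    double dual of M. *)
Lemma direct_sum_ind (P : U -> Prop) : P 0 ->
  (forall u v, P u -> P v -> P (u + v)) ->
  (forall i v, D i -> F i v -> P v) -> forall v, P v.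
Proof.
move=> P0 PD Ph v; have [r ur r0] := component_support v.
rewrite (component_sum ur r0); elim/big_ind: _ => // i _.
have [Di|Di] := pselect (D i); last by rewrite component_out.
by apply: (Ph i) => //; exact: component_mem.
Qed.

End DirectSums.

(** * Additive, linear and conjugate linear maps *)

Section AdditiveMaps.
Variables (U W : zmodType) (f : U -> W).
Hypothesis fD : {morph f : u v / u + v}.

Lemma morph0 : f 0 = 0.
Proof. by apply: (@addrI _ (f 0)); rewrite -fD !addr0. Qed.

Lemma morphN u : f (- u) = - f u.
Proof. by apply: (@addrI _ (f u)); rewrite -fD !subrr morph0. Qed.

Lemma morphB u v : f (u - v) = f u - f v.
Proof. by rewrite fD morphN. Qed.

Lemma morph_sum (J : Type) (r : seq J) (P : pred J) (g : J -> U) :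
  f (\sum_(j <- r | P j) g j) = \sum_(j <- r | P j) f (g j).
Proof. exact: (big_morph f fD morph0). Qed.

End AdditiveMaps.

Section LinearMaps.
Variables (R : realType) (U W : lmodType R[i]) (f : U -> W).

Lemma linear_morphD : linear f -> {morph f : u v / u + v}.
Proof. by move=> fl u v; rewrite -[u]scale1r fl !scale1r. Qed.

Lemma linear_morphZ : linear f -> forall c u, f (c *: u) = c *: f u.
Proof.
move=> fl c u; rewrite -[c *: u]addr0 fl (morph0 (linear_morphD fl)).
exact: addr0.
Qed.

Lemma conj_linear_morphD : conj_linear f -> {morph f : u v / u + v}.
Proof. by move=> fl u v; rewrite -[u]scale1r fl rmorph1 !scale1r. Qed.

Lemma conj_linear_morphZ : conj_linear f -> forall c u, f (c *: u) = c^* *: f u.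
Proof.
move=> fl c u; rewrite -[c *: u]addr0 fl (morph0 (conj_linear_morphD fl)).
exact: addr0.
Qed.

End LinearMaps.

(** * Binomial coefficients with complex upper argument *)

Section Binomials.
Variable R : realType.
Implicit Types x y : R[i].

Lemma gbinom0 x : gbinom x 0 = 1.
Proof. by rewrite /gbinom big_ord0 fact0 divr1. Qed.

Lemma gbinomS x j : j.+1%:R * gbinom x j.+1 = (x - j%:R) * gbinom x j.
Proof.
rewrite /gbinom big_ord_recr /= factS natrM.
have j0 : (j.+1%:R : R[i]) != 0 by rewrite pnatr_eq0.
have f0 : ((j`!)%:R : R[i]) != 0 by rewrite pnatr_eq0 -lt0n fact_gt0.
rewrite -natr1 in j0 *.
by field; rewrite f0 j0.
Qed.

Lemma gbinomSE x j : gbinom x j.+1 = (x - j%:R) * gbinom x j / j.+1%:R.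
Proof. by rewrite -gbinomS mulrC mulKf // pnatr_eq0. Qed.

Lemma gbinom1 x : gbinom x 1 = x.
Proof. by rewrite gbinomSE gbinom0 subr0 mulr1 divr1. Qed.

Lemma gbinom_pascal x j : gbinom (x + 1) j.+1 = gbinom x j.+1 + gbinom x j.
Proof.
elim: j => [|j IH]; first by rewrite !gbinom1 gbinom0.
rewrite gbinomSE IH [gbinom x j.+2]gbinomSE !gbinomSE.
have j0 : (j.+1%:R : R[i]) != 0 by rewrite pnatr_eq0.
have j1 : (j.+2%:R : R[i]) != 0 by rewrite pnatr_eq0.
rewrite -!natr1 in j0 j1 *.
by field; rewrite j0 j1.
Qed.

Lemma gbinom_nat_gt n j : (n < j)%N -> gbinom (n%:R : R[i]) j = 0.
Proof.
by move=> nj; rewrite /gbinom (bigD1 (Ordinal nj)) //= subrr !mul0r.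
Qed.

(** Induction on q. Multiply by q + 1, split as j + (q + 1 - j) in each term; by [gbinomS] the two
    sums combine to (x + y - q) times the sum for q. *)
Lemma gbinom_vandermonde x y q :
  \sum_(j < q.+1) gbinom x j * gbinom y (q - j) = gbinom (x + y) q.
Proof.
elim: q => [|q IH]; first by rewrite big_ord_recr big_ord0 /= !gbinom0 add0r mulr1.
have q0 : (q.+1%:R : R[i]) != 0 by rewrite pnatr_eq0.
apply: (mulfI q0); rewrite gbinomS -IH big_distrr /=.
transitivity (\sum_(j < q.+2) (j%:R * gbinom x j * gbinom y (q.+1 - j)) +
  \sum_(j < q.+2) (gbinom x j * ((q.+1 - j)%:R * gbinom y (q.+1 - j)))).
  rewrite -big_split /=; apply: eq_bigr => j _; rewrite natrB; last by rewrite -ltnS.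
  by ring.
rewrite big_ord_recl /= !mul0r add0r [X in _ + X]big_ord_recr /= subnn mul0r mulr0.
rewrite addr0 -big_split /= big_distrr /=; apply: eq_bigr => j _.
rewrite /bump /= add1n subSS gbinomS subSn; last by rewrite -ltnS.
rewrite gbinomS natrB; last by rewrite -ltnS.
by ring.
Qed.

Lemma gbinom_negate x j : gbinom (- x) j = (-1) ^+ j * gbinom (x + j%:R - 1) j.
Proof.
elim: j x => [|j IH] x; first by rewrite !gbinom0 expr0 mul1r.
have j0 : (j.+1%:R : R[i]) != 0 by rewrite pnatr_eq0.
apply: (mulfI j0); rewrite gbinomS IH -natr1.
have -> : x + (j%:R + 1) - 1 = (x + j%:R - 1) + 1 by ring.
rewrite gbinom_pascal exprS.
have := gbinomS (x + j%:R - 1) j; rewrite -natr1 => e.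
transitivity (- (-1) ^+ j * ((j%:R + 1) * gbinom (x + j%:R - 1) j.+1 +
  (j%:R + 1) * gbinom (x + j%:R - 1) j)).
  by rewrite e; ring.
by ring.
Qed.

(** Upper negation turns binom(x - j, q - j) into (-1)^(q - j) binom(q - 1 - x, q - j), whose upper
    argument no longer depends on j. Vandermonde applies, and a second negation gives the right
    side. *)
Lemma gbinom_alternating m x q :
  \sum_(j < q.+1) (-1) ^+ j * gbinom m j * gbinom (x - j%:R) (q - j)
  = gbinom (x - m) q.
Proof.
have -> : x - m = - (m - x) by ring.
rewrite gbinom_negate.
have -> : m - x + q%:R - 1 = m + (q%:R - 1 - x) by ring.
rewrite -gbinom_vandermonde big_distrr /=; apply: eq_bigr => j _.
have jq : (j <= q)%N by rewrite -ltnS.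
have -> : x - j%:R = - (j%:R - x) by ring.
rewrite gbinom_negate natrB //.
have -> : j%:R - x + (q%:R - j%:R) - 1 = q%:R - 1 - x by ring.
have -> : (-1 : R[i]) ^+ q = (-1) ^+ j * (-1) ^+ (q - j) by rewrite -exprD subnKC.
by ring.
Qed.

End Binomials.

(** * Translation, L_0 and L_1 on products a_(n) b *)

Section VertexAlgebraModes.
Variables (R : realType) (V : vertexAlgebra R).
Implicit Types (a b v : V) (n m : int).

Lemma nprodDl n b : {morph (fun a => nprod a n b) : u v / u + v}.
Proof. exact: linear_morphD (nprod_linearl n b). Qed.

Lemma nprodDr a n : {morph nprod a n : u v / u + v}.
Proof. exact: linear_morphD (nprod_linearr a n). Qed.

Lemma nprodZl c a n b : nprod (c *: a) n b = c *: nprod a n b.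
Proof. exact: (linear_morphZ (nprod_linearl n b)). Qed.

Lemma nprodZr c a n b : nprod a n (c *: b) = c *: nprod a n b.
Proof. exact: (linear_morphZ (nprod_linearr a n)). Qed.

Lemma nprod0l n b : nprod 0 n b = 0. Proof. exact: (morph0 (nprodDl n b)). Qed.

Lemma nprod0r a n : nprod a n 0 = 0. Proof. exact: (morph0 (nprodDr a n)). Qed.

(* The Borcherds identity with [b = 1], [n = -2], [k = 0]: its right side vanishes. *)
Lemma translation_nprod p a m v : parity p a ->
  nprod (translation a) m v = - m%:~R *: nprod a (m - 1) v.
Proof.
move=> pa; have := va_borcherds m (-2) 0 v pa (vac_even V); rewrite /borcherds.
rewrite (@fsum_nat _ 2); last first.
  move=> j j2; rewrite nprod_vac; last by lia.
  by rewrite ifF ?nprod0l ?scaler0 //; lia.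
rewrite [RHS]fsbig1; last first.
  move=> j _; rewrite !vac_nprod.
  rewrite ifF; last by lia.
  rewrite ifF ?nprod0r ?scaler0 ?subr0 ?scaler0 //; lia.
rewrite !big_ord_recr big_ord0 /= add0r gbinom0 gbinom1 scale1r !addr0.
rewrite (_ : -2 + 1 = -1 :> int) // [nprod a (-1) _]nprod_vac // /translation.
by move=> /eqP; rewrite addr_eq0 => /eqP ->; rewrite scaleNr.
Qed.

End VertexAlgebraModes.

Section ConformalModes.
Variables (R : realType) (V : conformalVertexAlgebra R).
Implicit Types (a b v : V) (n m k : int).

(** Conformal weight k/2 with k an integer rather than a natural number: products and powers of L_1
    produce negative k, where [half_weight_lt0] leaves only the zero vector. *)
Definition half_weight k v : Prop := Lop 0 v = (k%:~R / 2) *: v.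

Lemma weight_half (k : nat) v : weight k v -> half_weight k v.
Proof. by []. Qed.

Lemma Lop_linear n : linear (@Lop R V n).
Proof. exact: nprod_linearr. Qed.

Lemma LopD n : {morph @Lop R V n : u v / u + v}.
Proof. exact: nprodDr. Qed.

Lemma LopZ n c v : Lop n (c *: v) = c *: Lop n v.
Proof. exact: nprodZr. Qed.

Lemma Lop_parity n p v : parity p v -> parity p (Lop n v).
Proof. by move=> pv; apply: (nprod_parity _ (cvec_even V) pv). Qed.

(** The Borcherds identity for L and a with middle index 0: only j = 0 survives on the right, and L
    is even, so no sign appears. *)
Lemma cvec_commutator p a b m n : parity p a ->
  nprod (cvec V) m (nprod a n b) - nprod a n (nprod (cvec V) m b)
  = \sum_(j \in [set: nat]) gbinom m%:~R j *:
      nprod (nprod (cvec V) j a) (m + n - j%:Z) b.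
Proof.
move=> pa; have := va_borcherds m 0 n b (cvec_even V) pa; rewrite /borcherds.
rewrite [X in _ = X -> _](@fsum_nat _ 1); last first.
  case=> // j _; rewrite (_ : 0%:~R = 0%N%:R) // gbinom_nat_gt //.
  by rewrite mulr0 scale0r.
rewrite big_ord_recr big_ord0 /= gbinom0 !expr0 mulr1 scale1r !add0r.
rewrite scale1r !subr0 => <-.
by apply: eq_fsbigr => j _; rewrite natz add0r.
Qed.

(** L_1 is the mode of L of index 2, so the commutator has three terms, from T a, L_0 a and L_1 a.
    The first two give -(n + 2) and 2 (k/2) times a_(n+1) b. *)
Lemma L1_nprod p k a b n : parity p a -> half_weight k a ->
  Lop 1 (nprod a n b) = nprod (Lop 1 a) n b
    + (k%:~R - 2 - n%:~R) *: nprod a (n + 1) b + nprod a n (Lop 1 b).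
Proof.
move=> pa ka; apply/eqP; rewrite -subr_eq; apply/eqP.
rewrite [LHS](cvec_commutator b (1 + 1) n pa) (@fsum_nat _ 3); last first.
  move=> j j3; rewrite (_ : (1 + 1)%:~R = 2%N%:R) // gbinom_nat_gt //.
  by rewrite scale0r.
rewrite !big_ord_recr big_ord0 /= add0r gbinom0 gbinom1 scale1r.
have -> : gbinom ((1 + 1)%:~R : R[i]) 2 = 1.
  by rewrite gbinomSE gbinom1 /= (_ : (1 + 1)%:~R = 2) //; field.
have -> : nprod (cvec V) 0 a = translation a by rewrite -virasoro_translation.
have -> : nprod (cvec V) 1 a = (k%:~R / 2) *: a by exact: ka.
rewrite (translation_nprod _ _ pa) nprodZl scalerA scale1r.
have -> : 1 + 1 + n - 0 - 1 = n + 1 :> int by ring.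
have -> : 1 + 1 + n - 1 = n + 1 :> int by ring.
have -> : 1 + 1 + n - 2 = n :> int by ring.
rewrite -scalerDl addrC; congr (_ + _ *: _).
rewrite !rmorphD rmorphN /= -!rmorphD /=.
by field.
Qed.

Lemma half_weight_nprod p ka kb a b n : parity p a ->
  half_weight ka a -> half_weight kb b ->
  half_weight (ka + kb - n - n - 2) (nprod a n b).
Proof.
move=> pa wa wb; rewrite /half_weight.
have := cvec_commutator b (0 + 1) n pa.
rewrite (@fsum_nat _ 2); last first.
  move=> j j3; rewrite (_ : (0 + 1)%:~R = 1%N%:R) // gbinom_nat_gt //.
  by rewrite scale0r.
rewrite !big_ord_recr big_ord0 /= add0r gbinom0 gbinom1 scale1r.
have -> : nprod (cvec V) 0 a = translation a by rewrite -virasoro_translation.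
have -> : nprod (cvec V) 1 a = (ka%:~R / 2) *: a by exact: wa.
rewrite [nprod (cvec V) _ b](_ : _ = (kb%:~R / 2) *: b); last exact: wb.
rewrite (translation_nprod _ _ pa) nprodZl nprodZr scalerA.
have -> : 0 + 1 + n - 0 - 1 = n :> int by ring.
have -> : 0 + 1 + n - 1 = n :> int by ring.
rewrite add0r -scalerDl => /eqP; rewrite subr_eq -scalerDl => /eqP.
rewrite /Lop /virasoro => ->; congr (_ *: _).
rewrite !rmorphD !rmorphN /=.
by field.
Qed.

Lemma half_weight_L1 k v : half_weight k v -> half_weight (k - 2) (Lop 1 v).
Proof.
move=> kv; have vir : Lop 0 (Lop 1 v) - Lop 1 (Lop 0 v) = - Lop 1 v.
  have := virasoro_rel 0 1 v; rewrite !add0r.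
  by rewrite (_ : (1 == 0 :> int) = false) // mulr0 mul0r scale0r addr0 scaleN1r.
move/eqP: vir; rewrite subr_eq kv LopZ -scaleN1r -scalerDl => /eqP vir.
rewrite /half_weight vir.
by congr (_ *: _); rewrite !rmorphB /=; field.
Qed.

Lemma weight_direct_sum : direct_sum [set: nat] (@weight R V).
Proof. exact: weight_direct. Qed.

Local Notation wc := (@weight_component R V).

Lemma Lop0_component v (k : nat) : wc (Lop 0 v) k = (k%:R / 2) *: wc v k.
Proof.
have [r ur r0] := component_support weight_direct_sum v.
rewrite /weight_component.
pose x (j : nat) := (j%:R / 2 : R[i]) *: component setT (@weight R V) v j.
rewrite -[RHS]/(x k); move: k; apply: (component_eq weight_direct_sum ur) => //.
- move=> j _; apply: subspaceZ; first exact: (ds_subspace weight_direct_sum).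
  exact: (component_mem weight_direct_sum).
- by move=> j [].
- by move=> j /r0 vj; rewrite /x vj scaler0.
rewrite {1}(component_sum weight_direct_sum ur r0) (morph_sum (LopD 0)).
by apply: eq_bigr => j _; have := component_mem weight_direct_sum v (I : [set: nat] j).
Qed.

(** L_0 multiplies the component of weight j/2 by j/2, and a negative k differs from every natural
    j, so every component is zero. All vanishing of high powers of L_1 comes from here. *)
Lemma half_weight_lt0 k v : k < 0 -> half_weight k v -> v = 0.
Proof.
move=> k0 kv; apply: (component_inj weight_direct_sum) => j.
rewrite (component0 weight_direct_sum); have := Lop0_component v j.
rewrite kv /weight_component (componentZ weight_direct_sum) => /eqP.
rewrite -subr_eq0 -scalerBl scaler_eq0 => /orP[|/eqP //].
rewrite -mulrBl mulf_eq0 invr_eq0 pnatr_eq0 orbF subr_eq0 => /eqP.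
by rewrite [j%:R]pmulrn => /intr_inj; lia.
Qed.

Definition L1div (s : nat) v : V := (s`!)%:R^-1 *: iter s (Lop 1) v.

Lemma L1div0 v : L1div 0 v = v.
Proof. by rewrite /L1div fact0 invr1 scale1r. Qed.

Lemma L1divS s v : Lop 1 (L1div s v) = s.+1%:R *: L1div s.+1 v.
Proof.
rewrite /L1div LopZ /= scalerA factS natrM invfM mulrA divff ?mul1r // pnatr_eq0.
Qed.

Lemma L1divSE s v : L1div s.+1 v = s.+1%:R^-1 *: Lop 1 (L1div s v).
Proof. by rewrite L1divS scalerA mulVf ?scale1r // pnatr_eq0. Qed.

Lemma L1div_ind (P : V -> Prop) s v : (forall c u, P u -> P (c *: u)) ->
  (forall u, P u -> P (Lop 1 u)) -> P v -> P (L1div s v).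
Proof. by move=> PZ PL Pv; apply: PZ; elim: s => //= s Ps; exact: PL. Qed.

Lemma L1div_linear s : linear (L1div s).
Proof.
elim: s => [|s IH] c u v; first by rewrite !L1div0.
by rewrite !L1divSE IH Lop_linear scalerDr !scalerA mulrC.
Qed.

Lemma L1div_parity s p v : parity p v -> parity p (L1div s v).
Proof.
apply: L1div_ind => [c u|u]; last exact: Lop_parity.
by apply: subspaceZ; exact: (ds_subspace (parity_direct V)).
Qed.

Lemma half_weight_L1div s k v :
  half_weight k v -> half_weight (k - s%:Z - s%:Z) (L1div s v).
Proof.
move=> kv; elim: s => [|s IH]; first by rewrite L1div0 !subr0.
have := half_weight_L1 IH; rewrite L1divSE /half_weight (LopZ 0 s.+1%:R^-1) => ->.
by rewrite !scalerA mulrC; congr (_%:~R / _ * _ *: _); lia.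
Qed.

Lemma L1div_eq0 s k v : half_weight k v -> k < s%:Z + s%:Z -> L1div s v = 0.
Proof.
by move=> kv ks; apply: half_weight_lt0 (half_weight_L1div s kv); lia.
Qed.

End ConformalModes.

(** * Conjugation of products by e^(z L_1) *)

Section SlTwoCovariance.
Variables (R : realType) (V : conformalVertexAlgebra R).
Implicit Types (a b v : V) (n m k : int).

(* The coefficient form of
   e^(z L_1) Y(a, w) e^(-z L_1)
     = Y(e^(z (1 - z w) L_1) (1 - z w)^(-2 L_0) a, w / (1 - z w)). *)
Lemma L1div_nprod p k a b n N s : parity p a -> half_weight k a -> (s <= N)%N ->
  L1div s (nprod a n b) =
  \sum_(u < N.+1) \sum_(r < N.+1) \sum_(t < N.+1)
    ((u + r + t == s)%N%:R * gbinom ((k - 2 - n)%:~R - u%:R) r) *: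
      nprod (L1div u a) (n + r%:Z) (L1div t b).
Proof.
move=> pa ka; set x : R[i] := (k - 2 - n)%:~R.
pose X u r t := nprod (L1div u a) (n + r%:Z) (L1div t b).
elim: s => [_|s IH sN].
  rewrite (@sum_nat_pick _ N.+1 0 (fun u => \sum_(r < N.+1) \sum_(t < N.+1)
    ((u + r + t == 0)%N%:R * gbinom (x - u%:R) r) *: X u r t)) //; last first.
    case=> // u _; rewrite big1 // => r _; rewrite big1 // => t _.
    by rewrite !addSn mul0r scale0r.
  rewrite (@sum_nat_pick _ N.+1 0 (fun r => \sum_(t < N.+1)
    ((0 + r + t == 0)%N%:R * gbinom (x - 0%:R) r) *: X 0%N r t)) //; last first.
    case=> // r _; rewrite big1 // => t _.
    by rewrite add0n addSn mul0r scale0r.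
  rewrite (@sum_nat_pick _ N.+1 0 (fun t =>
    ((0 + 0 + t == 0)%N%:R * gbinom (x - 0%:R) 0) *: X 0%N 0%N t)) //; last first.
    by case=> // t _; rewrite mul0r scale0r.
  by rewrite /X !L1div0 addr0 gbinom0 mulr1 scale1r.
have s0 : (s.+1%:R : R[i]) != 0 by rewrite pnatr_eq0.
apply: (scalerI s0); rewrite -L1divS (IH (ltnW sN)).
(* [A1], [A2], [A3] are the terms of [L1_nprod]: L_1 on the left factor, the index raised, L_1 on
   the right factor. [B1], [B2], [B3] are the same terms after u, r or t is raised by one, so that
   all are multiples of the same [X u r t]. *)
pose c u r t : R[i] := (u + r + t == s)%N%:R * gbinom (x - u%:R) r.
pose A1 u r t := (c u r t * u.+1%:R) *: X u.+1 r t.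
pose A2 u r t := (c u r t * (x - u%:R - u%:R - r%:R)) *: X u r.+1 t.
pose A3 u r t := (c u r t * t.+1%:R) *: X u r t.+1.
pose e u r t : R[i] := (u + r + t == s.+1)%N%:R.
pose B1 u r t := (e u r t * (u%:R * gbinom (x - u%:R + 1) r)) *: X u r t.
pose B2 u r t := (e u r t * (if r is r'.+1 then
  (x - u%:R - u%:R - r'%:R) * gbinom (x - u%:R) r' else 0)) *: X u r t.
pose B3 u r t := (e u r t * (t%:R * gbinom (x - u%:R) r)) *: X u r t.
(* As s < N, the indicator vanishes on the top faces of the box, so the raised sums keep their
   range. *)
have out i j : (N + i + j == s)%N = false.
  by apply/negbTE; rewrite neq_ltn -addnA ltn_addr ?orbT.
transitivity (\sum_(u < N.+1) \sum_(r < N.+1) \sum_(t < N.+1)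
  (A1 u r t + A2 u r t + A3 u r t)).
  rewrite (morph_sum (LopD 1)); apply: eq_bigr => u _.
  rewrite (morph_sum (LopD 1)); apply: eq_bigr => r _.
  rewrite (morph_sum (LopD 1)); apply: eq_bigr => t _.
  rewrite LopZ (L1_nprod _ _ (L1div_parity u pa) (half_weight_L1div u ka)).
  rewrite !L1divS nprodZl nprodZr !scalerDr !scalerA; congr (_ + _ *: _ + _).
    rewrite /c /x !rmorphB /= !rmorphD /=; ring.
  rewrite /X; congr nprod; lia.
transitivity (\sum_(u < N.+1) \sum_(r < N.+1) \sum_(t < N.+1)
  (B1 u r t + B2 u r t + B3 u r t)).
  have split3 (P1 P2 P3 : nat -> nat -> nat -> V) :
    \sum_(u < N.+1) \sum_(r < N.+1) \sum_(t < N.+1) (P1 u r t + P2 u r t + P3 u r t)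
    = \sum_(u < N.+1) \sum_(r < N.+1) \sum_(t < N.+1) P1 u r t +
      \sum_(u < N.+1) \sum_(r < N.+1) \sum_(t < N.+1) P2 u r t +
      \sum_(u < N.+1) \sum_(r < N.+1) \sum_(t < N.+1) P3 u r t.
    rewrite -!big_split /=; apply: eq_bigr => u _.
    rewrite -!big_split /=; apply: eq_bigr => r _.
    by rewrite -!big_split.
  rewrite !split3; congr (_ + _ + _).
  - apply: (@shift_sum _ N (fun u => \sum_(r < N.+1) \sum_(t < N.+1) A1 u r t)
      (fun u => \sum_(r < N.+1) \sum_(t < N.+1) B1 u r t)).
    + move=> u; apply: eq_bigr => r _; apply: eq_bigr => t _.
      rewrite /A1 /B1 /c /e !addSn eqSS; congr (_ *: _).
      rewrite (_ : x - u.+1%:R + 1 = x - u%:R); last by rewrite -natr1; ring.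
      by ring.
    + by rewrite big1 // => r _; rewrite big1 // => t _; rewrite /B1 mul0r mulr0 scale0r.
    + by rewrite big1 // => r _; rewrite big1 // => t _; rewrite /A1 /c out !mul0r scale0r.
  - apply: eq_bigr => u _.
    apply: (@shift_sum _ N (fun r => \sum_(t < N.+1) A2 u r t)
      (fun r => \sum_(t < N.+1) B2 u r t)).
    + move=> r; apply: eq_bigr => t _.
      rewrite /A2 /B2 /c /e !addnS !addSn eqSS; congr (_ *: _); ring.
    + by rewrite big1 // => t _; rewrite /B2 mulr0 scale0r.
    + by rewrite big1 // => t _; rewrite /A2 /c [(u + N)%N]addnC out !mul0r scale0r.
  - apply: eq_bigr => u _; apply: eq_bigr => r _.
    apply: (@shift_sum _ N (fun t => A3 u r t) (fun t => B3 u r t)).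
    + by move=> t; rewrite /A3 /B3 /c /e addnS eqSS; congr (_ *: _); ring.
    + by rewrite /B3 mul0r mulr0 scale0r.
    + by rewrite /A3 /c addnC addnA out !mul0r scale0r.
rewrite scaler_sumr; apply: eq_bigr => u _.
rewrite scaler_sumr; apply: eq_bigr => r _.
rewrite scaler_sumr; apply: eq_bigr => t _.
rewrite /B1 /B2 /B3 -!scalerDl scalerA /e; congr (_ *: _).
(* With y = x - u and r > 0 this is u binom(y + 1, r) + (y - u - r + 1) binom(y, r - 1) + t binom(y,
   r) = (u + r + t) binom(y, r): Pascal's rule on the first term, then r binom(y, r) = (y - r + 1)
   binom(y, r - 1). *)
case: eqP => [<-|_]; last by rewrite !mul0r mulr0 !addr0.
rewrite !mul1r; case: (nat_of_ord r) => [|r'].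
  by rewrite !gbinom0 !natrD; ring.
rewrite gbinom_pascal !natrD -natr1.
have := gbinomS (x - u%:R) r'; rewrite -natr1 => e1.
transitivity (u%:R * gbinom (x - u%:R) r'.+1 + (x - u%:R - r'%:R) * gbinom (x - u%:R) r'
   + t%:R * gbinom (x - u%:R) r'.+1); first by ring.
by rewrite -e1; ring.
Qed.

End SlTwoCovariance.

(** * Convolution sums, uniform bounds, cosets of Z *)

Section Convolution.
Variables (R : realType) (W : lmodType R[i]).

(** Grouping by q = j + r turns the square into a triangle; the vanishing of [Z] discards the corner
    j + r >= N. *)
Lemma sum_convolution (N : nat) (d : nat -> nat -> R[i]) (Z : nat -> W) :
  (forall q, (N <= q)%N -> Z q = 0) ->
  \sum_(j < N) \sum_(r < N) d j r *: Z (j + r)%N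
  = \sum_(q < N) (\sum_(j < q.+1) d j (q - j)%N) *: Z q.
Proof.
move=> Z0.
transitivity (\sum_(j < N) \sum_(q < N | (j <= q)%N) d j (q - j)%N *: Z q).
  apply: eq_bigr => j _; have jN : (j <= N)%N by exact: ltnW.
  rewrite -(big_geq_mkord _ _ xpredT (fun q => d j (q - j)%N *: Z q)).
  have -> : \sum_(j <= q < N) d j (q - j)%N *: Z q
      = \sum_(r < N - j) d j (r + j - j)%N *: Z (r + j)%N.
    by rewrite -{1}[nat_of_ord j]add0n big_addn big_mkord.
  rewrite [RHS](@sum_nat_widen _ _ N (fun r => d j (r + j - j)%N *: Z (r + j)%N)).
  - by apply: eq_bigr => r _; rewrite addnK addnC.
  - exact: leq_subr.
  - by move=> r Nr; rewrite Z0 ?scaler0 //; lia.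
rewrite (exchange_big_dep xpredT) //=; apply: eq_bigr => q _.
rewrite scaler_suml (big_ord_widen N (fun j => d j (q - j)%N *: Z q)) //.
Qed.

End Convolution.

Section Eventually.

Lemma eventually_uniform (P : nat -> nat -> Prop) (K : nat) :
  (forall u, exists N, forall j, (N <= j)%N -> P u j) ->
  exists N, forall u j, (u < K)%N -> (N <= j)%N -> P u j.
Proof.
move=> Pev; elim: K => [|K [N NP]]; first by exists 0%N.
have [N' N'P] := Pev K; exists (maxn N N') => u j uK; rewrite geq_max => /andP[Nj N'j].
move: uK; rewrite ltnS leq_eqVlt => /orP[/eqP ->|uK]; first exact: N'P.
exact: NP.
Qed.

Lemma eventually_natr_ge (R : realType) (x c : R) :
  exists J : nat, forall j, (J <= j)%N -> x <= c + j%:R.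
Proof.
exists (Num.bound `|x - c|) => j Jj; rewrite addrC -lerBlDr.
apply: (le_trans (ler_norm _)); apply: ltW.
apply: (lt_le_trans (archi_boundP (normr_ge0 _))).
by rewrite ler_nat.
Qed.

End Eventually.

Section Zcosets.
Variable R : realType.
Implicit Types x y : R.

Lemma Zcoset_addz x y (n : int) : Zcoset x y -> Zcoset x (y + n%:~R).
Proof. by case=> i _ <-; exists (i + n) => //; rewrite intrD addrA. Qed.

Lemma ZcosetN x y : Zcoset x y -> Zcoset (- x) (- y).
Proof. by case=> i _ <-; exists (- i) => //; rewrite intrN opprD. Qed.

End Zcosets.

(** * The Borcherds identity for opposite modes of homogeneous vectors *)

Section TwistedModes.
Variables (R : realType) (V : conformalVertexAlgebra R).
Variables (Gamma : set R) (hGamma : subgroup_with_Z Gamma).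
Variables (Ups : set R -> set V) (hUps : graded_mod_Z Gamma Ups).
Hypothesis hUpsL : Ups (Zcoset 0) (cvec V).
Variables (M : lmodType R[i]) (parM : bool -> set M) (Y : V -> R -> M -> M).
Hypothesis hM : twisted_module Gamma Ups parM Y.
Implicit Types (a b v : V) (x : M).

Lemma Gamma0 : Gamma 0.
Proof. exact: (hGamma.1 0). Qed.

Lemma GammaN ga : Gamma ga -> Gamma (- ga).
Proof. by move=> gaG; rewrite -sub0r; apply: hGamma.2 => //; exact: Gamma0. Qed.

Lemma Ups_subspace ga : Gamma ga -> Defs.subspace (Ups (Zcoset ga)).
Proof. by move=> gaG; case: (Ups_super hUps gaG). Qed.

Lemma Ups_Lop ga n v : Gamma ga -> Ups (Zcoset ga) v -> Ups (Zcoset ga) (Lop n v).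
Proof.
move=> gaG gav; rewrite -[ga]add0r; by apply: (Ups_nprod hUps) => //; exact: Gamma0.
Qed.

Lemma Ups_L1div ga s v : Gamma ga -> Ups (Zcoset ga) v ->
  Ups (Zcoset ga) (L1div s v).
Proof.
move=> gaG; apply: L1div_ind => [c u|u]; last exact: Ups_Lop.
by apply: subspaceZ; exact: Ups_subspace.
Qed.

Lemma YDl m x : {morph (fun a => Y a m x) : u v / u + v}.
Proof. exact: linear_morphD (tm_linearl hM m x). Qed.

Lemma YZl c a m x : Y (c *: a) m x = c *: Y a m x.
Proof. exact: (linear_morphZ (tm_linearl hM m x)). Qed.

Lemma Y0l m x : Y 0 m x = 0.
Proof. exact: (morph0 (YDl m x)). Qed.

Lemma YDr a m : {morph Y a m : x y / x + y}.
Proof. exact: linear_morphD (tm_linearr hM a m). Qed.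

Lemma Y0r a m : Y a m 0 = 0.
Proof. exact: (morph0 (YDr a m)). Qed.

(* For [v] of conformal weight [k/2], the coefficient of [z^(-n-1)] in
   [Y (e^(z L_1) z^(-2 L_0) v, z^(-1)) x]; longer sums have zero extra terms. *)
Definition opp_mode_hw (k : int) v (n : R) x : M :=
  \sum_(s < `|k|.+1) Y (L1div s v) (k%:~R - 2 - n - s%:R) x.

Lemma opp_mode_hw_widen k v n x N : half_weight k v -> (`|k| < N)%N ->
  opp_mode_hw k v n x = \sum_(s < N) Y (L1div s v) (k%:~R - 2 - n - s%:R) x.
Proof.
move=> kv kN; apply: (@sum_nat_widen _ `|k|.+1 N
  (fun s => Y (L1div s v) (k%:~R - 2 - n - s%:R) x)) => // s ks.
by rewrite (L1div_eq0 kv) ?Y0l //; lia.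
Qed.

Lemma mode_field a c x : exists N, forall j, (N <= j)%N -> Y a (c + j%:R) x = 0.
Proof.
have [r rP] := tm_field hM a x; have [J JP] := eventually_natr_ge r c.
by exists J => j /JP; exact: rP.
Qed.

(** Meant for g a and g b in place of a and b; the sign (-1)^j on the left is the j-dependent part
    of the phase of g (a_(n+j) b). Opposite modes of V^[ga] have indices in -ga + Z, hence the
    cosets of - m and - k. Beyond the N0 found here all summands vanish, so the partial sums are the
    full sums. *)
Lemma opp_mode_hw_borcherds p q ga gb a b (ka kb : int) (m k : R) (n : int) x :
  Gamma ga -> Gamma gb -> Ups (Zcoset ga) a -> Ups (Zcoset gb) b ->
  parity p a -> parity q b -> half_weight ka a -> half_weight kb b ->
  Zcoset ga (- m) -> Zcoset gb (- k) ->
  exists N0, forall N, (N0 <= N)%N ->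
  \sum_(j < N) ((-1) ^+ j * gbinom m%:C j) *:
    opp_mode_hw (ka + kb - (n + j%:Z) - (n + j%:Z) - 2)
      (nprod a (n + j%:Z) b) (m + k - j%:R) x
  = \sum_(j < N) ((-1) ^+ j * gbinom n%:~R j) *:
    (opp_mode_hw ka a (m + j%:R) (opp_mode_hw kb b (k + n%:~R - j%:R) x)
     - ((-1) ^+ (p && q) * (-1) ^ n) *:
       opp_mode_hw kb b (k + j%:R) (opp_mode_hw ka a (m + n%:~R - j%:R) x)).
Proof.
move=> gaG gbG gaa gbb pa qb wa wb gam gbk.
(* The shift by n makes m' u + n - j = ka - 2 - (m + j) - u and k' t + j = kb - 2 - (k + n - j) - t,
   so the right sides agree term by term in j. *)
pose m' u : R := ka%:~R - 2 - m - n%:~R - u%:R.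
pose k' t : R := kb%:~R - 2 - k - n%:~R - t%:R.
pose K := maxn `|ka|.+1 `|kb|.+1.
have aK u : (K <= u)%N -> L1div u a = 0.
  by move=> Ku; apply: (L1div_eq0 wa); rewrite /K in Ku; lia.
have bK u : (K <= u)%N -> L1div u b = 0.
  by move=> Ku; apply: (L1div_eq0 wb); rewrite /K in Ku; lia.
have [Na NaP] := eventually_uniform K (fun u => mode_field (L1div u a) (m' u) x).
have [Nb NbP] := eventually_uniform K (fun t => mode_field (L1div t b) (k' t) x).
have a0 u j : (Na <= j)%N -> Y (L1div u a) (m' u + j%:R) x = 0.
  by have [uK|/aK ->] := ltnP u K; [exact: NaP|rewrite Y0l].
have b0 u j : (Nb <= j)%N -> Y (L1div u b) (k' u + j%:R) x = 0.
  by have [uK|/bK ->] := ltnP u K; [exact: NbP|rewrite Y0l].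
have ab0 u t (i : int) : ka - u%:Z - u%:Z + kb - t%:Z - t%:Z < i + i + 2 ->
    nprod (L1div u a) i (L1div t b) = 0.
  move=> lti; apply: half_weight_lt0
    (half_weight_nprod i (L1div_parity u pa) (half_weight_L1div u wa)
      (half_weight_L1div t wb)).
  by lia.
pose sg : R[i] := (-1) ^+ (p && q) * (-1) ^ n.
pose N1 := (`|ka| + `|kb| + `|n|).+2.
exists (maxn N1 (maxn Na Nb)) => N; rewrite !geq_max => /andP[N1N /andP[NaN NbN]].
pose Z u t j := Y (nprod (L1div u a) (n + j%:Z) (L1div t b)) (m' u + k' t - j%:R) x.
have Z0 u t j : (N <= j)%N -> Z u t j = 0.
  by move=> Nj; rewrite /Z ab0 ?Y0l //; rewrite /N1 in N1N; lia.
have borM u t :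
  \sum_(j < N) gbinom (m' u)%:C j *: Z u t j =
  \sum_(j < N) ((-1) ^+ j * gbinom n%:~R j) *:
    (Y (L1div u a) (m' u + n%:~R - j%:R) (Y (L1div t b) (k' t + j%:R) x)
     - sg *: Y (L1div t b) (k' t + n%:~R - j%:R) (Y (L1div u a) (m' u + j%:R) x)).
  have gm : Zcoset ga (m' u).
    have := Zcoset_addz (ka - 2 - n - u%:Z) gam; rewrite /m' !rmorphB /=.
    by congr (Zcoset ga _); ring.
  have gk : Zcoset gb (k' t).
    have := Zcoset_addz (kb - 2 - n - t%:Z) gbk; rewrite /k' !rmorphB /=.
    by congr (Zcoset gb _); ring.
  have := tm_borcherds hM n x gaG gbG (Ups_L1div u gaG gaa) (Ups_L1div t gbG gbb)
    (L1div_parity u pa) (L1div_parity t qb) gm gk.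
  rewrite /borcherds (@fsum_nat _ N) => [|j Nj]; last first.
    by have := Z0 u t j Nj; rewrite /Z => ->; rewrite scaler0.
  move=> ->; rewrite (@fsum_nat _ N) // => j Nj.
  by rewrite a0 ?b0 ?Y0r ?scaler0 ?subr0 ?scaler0 //; lia.
(* S bounds the doubled weights of a, b and every a_(n+j) b with j < N, so all opposite modes become
   sums over one range. The existential keeps its value opaque. *)
have [S SE] : exists S, S = ((`|ka| + `|kb| + `|n| + N) * 2).+2 by eexists.
have NS : (N <= S.+1)%N by rewrite SE; lia.
have kaS : (`|ka| < S.+1)%N by rewrite SE; lia.
have kbS : (`|kb| < S.+1)%N by rewrite SE; lia.
transitivity (\sum_(u < S.+1) \sum_(t < S.+1)
  \sum_(j < N) gbinom (m' u)%:C j *: Z u t j); last first.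
  transitivity (\sum_(u < S.+1) \sum_(t < S.+1)
    \sum_(j < N) ((-1) ^+ j * gbinom n%:~R j) *:
    (Y (L1div u a) (m' u + n%:~R - j%:R) (Y (L1div t b) (k' t + j%:R) x)
     - sg *: Y (L1div t b) (k' t + n%:~R - j%:R) (Y (L1div u a) (m' u + j%:R) x))).
    by apply: eq_bigr => u _; apply: eq_bigr => t _; rewrite borM.
  under eq_bigr => u _ do rewrite exchange_big /=.
  rewrite exchange_big /=; apply: eq_bigr => j _.
  under eq_bigr => u _ do rewrite -scaler_sumr.
  rewrite -scaler_sumr; congr (_ *: _).
  under eq_bigr => u _ do rewrite sumrB.
  rewrite sumrB; congr (_ - _).
    rewrite (opp_mode_hw_widen _ _ wa kaS) (opp_mode_hw_widen _ _ wb kbS).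
    apply: eq_bigr => u _; rewrite (morph_sum (YDr _ _)); apply: eq_bigr => t _.
    by congr (Y _ _ (Y _ _ _)); rewrite /m' /k'; ring.
  rewrite (opp_mode_hw_widen _ _ wa kaS) (opp_mode_hw_widen _ _ wb kbS).
  rewrite exchange_big scaler_sumr; apply: eq_bigr => t _.
  rewrite (morph_sum (YDr _ _)) scaler_sumr; apply: eq_bigr => u _.
  by congr (_ *: Y _ _ (Y _ _ _)); rewrite /m' /k'; ring.
(* [gbinom_alternating] at x = ka - 2 - n - u, where x - m = m' u: the index q of the identity on M
   splits as q = j + r, with j from the opposite identity and r from [L1div_nprod]. *)
transitivity (\sum_(u < S.+1) \sum_(t < S.+1) \sum_(j < N) \sum_(r < N)
   ((-1) ^+ j * gbinom m%:C j * gbinom ((ka - 2 - n)%:~R - u%:R - j%:R) r) *: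
     Z u t (j + r)%N); last first.
  apply: eq_bigr => u _; apply: eq_bigr => t _.
  rewrite (@sum_convolution _ _ N (fun j r =>
    (-1) ^+ j * gbinom m%:C j * gbinom ((ka - 2 - n)%:~R - u%:R - j%:R) r));
    last exact: Z0.
  apply: eq_bigr => j _; rewrite gbinom_alternating; congr (gbinom _ _ *: _).
  rewrite /m' !rmorphB /= !rmorph_int !rmorph_nat; ring.
under [RHS]eq_bigr => u _ do rewrite exchange_big /=.
rewrite [RHS]exchange_big /=; apply: eq_bigr => j _.
have jN : (j < N)%N by [].
under [RHS]eq_bigr => u _ do under eq_bigr => t _ do
  under eq_bigr => r _ do rewrite -scalerA.
under [RHS]eq_bigr => u _ do under eq_bigr => t _ do rewrite -scaler_sumr.
under [RHS]eq_bigr => u _ do rewrite -scaler_sumr.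
rewrite -[RHS]scaler_sumr; congr (_ *: _).
have wab := half_weight_nprod (n + j%:Z) pa wa wb.
have kjS : (`|(ka + kb - (n + j%:Z) - (n + j%:Z) - 2)%R| < S.+1)%N by rewrite SE; lia.
rewrite (opp_mode_hw_widen _ _ wab kjS).
transitivity (\sum_(s < S.+1) \sum_(u < S.+1) \sum_(r < S.+1) \sum_(t < S.+1)
   ((u + r + t == s)%N%:R * gbinom ((ka - 2 - n)%:~R - u%:R - j%:R) r) *:
   Y (nprod (L1div u a) (n + (j + r)%N%:Z) (L1div t b))
     (m' u + k' t - (j + r)%:R + u%:R + r%:R + t%:R - s%:R) x).
  apply: eq_bigr => s _.
  have sS : (s <= S)%N by rewrite -ltnS.
  rewrite (L1div_nprod b _ pa wa sS).
  rewrite (morph_sum (YDl _ _)); apply: eq_bigr => u _.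
  rewrite (morph_sum (YDl _ _)); apply: eq_bigr => r _.
  rewrite (morph_sum (YDl _ _)); apply: eq_bigr => t _.
  rewrite YZl; congr ((_ * gbinom _ _) *: Y (nprod _ _ _) _ _).
  - rewrite !rmorphB /= rmorphD /=; ring.
  - by rewrite PoszD addrA.
  - rewrite /m' /k' ; ring.
rewrite exchange_big /=; apply: eq_bigr => u _.
rewrite exchange_big /= [RHS]exchange_big /=.
rewrite [RHS](@sum_nat_widen _ N S.+1 (fun r => \sum_(t < S.+1)
  gbinom ((ka - 2 - n)%:~R - u%:R - j%:R) r *: Z u t (j + r)%N)) //; last first.
  move=> r Nr; rewrite big1 // => t _; rewrite Z0 ?scaler0 //.
  exact: leq_trans (leq_addl _ _).
apply: eq_bigr => r _; rewrite exchange_big /=; apply: eq_bigr => t _.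
(* The indicator selects s = u + r + t. If this exceeds S, the product has negative weight and both
   sides vanish. *)
have [urt|urt] := ltnP (u + r + t) S.+1; last first.
  rewrite /Z ab0; last by lia.
  by rewrite Y0l scaler0; apply: big1 => s _; rewrite Y0l scaler0.
rewrite (@sum_nat_pick _ S.+1 (u + r + t) (fun s =>
   ((u + r + t == s)%N%:R * gbinom ((ka - 2 - n)%:~R - u%:R - j%:R) r) *:
   Y (nprod (L1div u a) (n + (j + r)%N%:Z) (L1div t b))
     (m' u + k' t - (j + r)%:R + u%:R + r%:R + t%:R - s%:R) x)) //; last first.
  by move=> s; rewrite eq_sym => /negbTE ->; rewrite mul0r scale0r.
rewrite eqxx mul1r /Z; congr (_ *: Y _ _ _).
by rewrite !natrD; ring.
Qed.

End TwistedModes.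

(** * The phases in g *)

Section Phases.
Variable R : realType.
Implicit Types s t : R.

Lemma expiD s t : expi (s + t) = expi s * expi t.
Proof. by rewrite /expi cosD sinD; congr Complex; ring. Qed.

Lemma expi0 : expi (0 : R) = 1.
Proof. by rewrite /expi cos0 sin0. Qed.

Lemma expi_conj t : (expi t)^* = expi (- t).
Proof. by rewrite /expi cosN sinN. Qed.

Lemma expi_pi : expi (pi : R) = -1.
Proof. by rewrite /expi cospi sinpi; apply/eqP; rewrite eq_complex /= oppr0 !eqxx. Qed.

Lemma expi_pi_nat (n : nat) : expi (pi * n%:R : R) = (-1) ^+ n.
Proof.
elim: n => [|n IH]; first by rewrite mulr0 expi0.
by rewrite -natr1 mulrDr mulr1 expiD IH expi_pi exprSr.
Qed.

Lemma expi_pi_int (n : int) : expi (pi * n%:~R : R) = (-1) ^ n.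
Proof.
case: n => n; first exact: expi_pi_nat.
have -> : (pi * (Negz n)%:~R : R) = - (pi * n.+1%:R) by rewrite NegzE intrN mulrN.
rewrite -expi_conj expi_pi_nat rmorphXn /= rmorphN1 NegzE.
by rewrite -exprnN -exprVn invrN1.
Qed.

Lemma signz_sqr (n : int) : ((-1) ^ n * (-1) ^ n : R[i]) = 1.
Proof. by rewrite -expfzMl mulrNN mulr1 exp1rz. Qed.

Definition phase (k : int) (p : bool) : R[i] :=
  expi (- (pi * (k%:~R / 2 + p%:R / 2))).

(** The weight of a_(n) b is the sum of the weights minus n + 1, which contributes e^(i pi (n + 1))
    = - (-1)^n. The parity of the product is p + q - 2 p q, and the coefficient 1/2 of the parity in
    g turns the correction into (-1)^(p q). *)
Lemma phase_nprod ka kb n (p q : bool) :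
  phase (ka + kb - n - n - 2) (p (+) q)
  = - ((-1) ^+ (p && q) * (-1) ^ n) * (phase ka p * phase kb q).
Proof.
have pqE : ((p (+) q)%:R : R) = p%:R + q%:R - (p && q)%:R - (p && q)%:R.
  by case: p; case: q => /=; ring.
rewrite -expi_pi_nat -expi_pi_int.
transitivity (expi (pi : R) * (expi (pi * (p && q)%:R) * expi (pi * n%:~R)) *
  (phase ka p * phase kb q)); last by rewrite expi_pi mulN1r.
by rewrite /phase -!expiD; congr expi; rewrite pqE; field.
Qed.

End Phases.

(** * Weight and parity components *)

Section WeightComponents.
Variables (R : realType) (V : conformalVertexAlgebra R).
Implicit Types (u v : V).

Lemma weight_component_bound v : exists K, forall k, (K <= k)%N ->
  weight_component v k = 0.
Proof.
have [r _ r0] := component_support (weight_direct_sum V) v.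
exists (\max_(i <- r) i).+1 => k Kk; apply: r0; apply/negP => kr.
move: Kk; rewrite ltnNge => /negP[].
exact: (@leq_bigmax_seq _ r xpredT (fun i : nat => i) k).
Qed.

Lemma weight_component_sum v K : (forall k, (K <= k)%N -> weight_component v k = 0) ->
  v = \sum_(k < K) weight_component v k.
Proof.
move=> K0; rewrite {1}(@component_sum _ _ _ _ _ (weight_direct_sum V) v (iota 0 K)).
- by rewrite -(big_mkord xpredT (weight_component v)) /index_iota subn0.
- exact: iota_uniq.
- by move=> i; rewrite mem_iota /= add0n -leqNgt; exact: K0.
Qed.

Lemma weight_component_mem v k : weight k (weight_component v k).
Proof. exact: (component_mem (weight_direct_sum V)). Qed.

Lemma weight_component_hom k v i : weight k v ->
  weight_component v i = if i == k then v else 0.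
Proof. by move=> kv; apply: (component_hom (weight_direct_sum V)). Qed.

(* [L_0 - K/2] kills the top component of weight [K/2] and rescales the lower
   ones by nonzero factors. *)
Lemma stable_weight_sum (S : set V) (K : nat) (x : nat -> V) :
  Defs.subspace S -> (forall v, S v -> S (Lop 0 v)) ->
  (forall k, weight k (x k)) -> S (\sum_(k < K) x k) ->
  forall k, (k < K)%N -> S (x k).
Proof.
move=> Ssub SL; elim: K x => [//|K IH] x xw Sx.
have Slow k : (k < K)%N -> S (x k).
  move=> kK.
  have k0 : ((k%:R - K%:R) / 2 : R[i]) != 0.
    by rewrite mulf_neq0 // subr_eq0 eqr_nat neq_ltn kK.
  rewrite -[x k](scalerK k0); apply: subspaceZ => //.
  apply: (IH (fun k => ((k%:R - K%:R) / 2) *: x k)) => //.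
    by move=> i; apply: subspaceZ; [exact: (ds_subspace (weight_direct_sum V))|exact: xw].
  have := subspaceB Ssub (SL _ Sx) (subspaceZ Ssub (K%:R / 2) Sx).
  rewrite (morph_sum (LopD 0)) scaler_sumr -sumrB big_ord_recr /=.
  have -> : Lop 0 (x K) - (K%:R / 2) *: x K = 0.
    by apply/eqP; rewrite subr_eq0; apply/eqP; exact: xw.
  rewrite addr0; congr S; apply: eq_bigr => i _.
  by rewrite [Lop 0 _]xw -scalerBl -mulrBl.
move=> k; rewrite ltnS leq_eqVlt => /orP[/eqP ->|]; last exact: Slow.
move: Sx; rewrite big_ord_recr /= => Sx.
have Ssum : S (\sum_(i < K) x i) by apply: subspace_sum => // i _; exact: Slow.
by have := subspaceB Ssub Sx Ssum; rewrite addrAC subrr add0r.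
Qed.

(** An L_0-stable subspace contains the weight components of its vectors, so the induction never
    leaves S. It is used with S a parity part of V or of V^[gamma]. *)
Lemma weight_ind (S : set V) (P : V -> Prop) :
  Defs.subspace S -> (forall v, S v -> S (Lop 0 v)) -> P 0 ->
  (forall u v, P u -> P v -> P (u + v)) ->
  (forall k v, S v -> weight k v -> P v) -> forall v, S v -> P v.
Proof.
move=> Ssub SL P0 PD Ph v Sv; have [K K0] := weight_component_bound v.
have vE := weight_component_sum K0.
rewrite vE; elim/big_ind: _ => // k _.
apply: (Ph k); last exact: weight_component_mem.
apply: (stable_weight_sum Ssub SL (weight_component_mem v) _ (ltn_ord k)).
by rewrite -vE.
Qed.

Lemma parity_subspace p : Defs.subspace (@parity R V p).
Proof. exact: (ds_subspace (parity_direct V)). Qed.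

Lemma parity_component_hom p v q : parity p v ->
  parity_component v q = if q == p then v else 0.
Proof. by move=> pv; apply: (component_hom (parity_direct V)). Qed.

Lemma parity_component_sum v :
  v = parity_component v false + parity_component v true.
Proof.
rewrite {1}(@component_sum _ _ _ _ _ (parity_direct V) v [:: false; true]) //.
  by rewrite big_cons big_seq1.
by case.
Qed.

Lemma Lop_parity_component n v p :
  parity_component (Lop n v) p = Lop n (parity_component v p).
Proof.
rewrite {1}(parity_component_sum v) LopD /parity_component.
rewrite (componentD (parity_direct V)) -/(parity_component _ p).
have pc q : parity q (Lop n (parity_component v q)).
  by apply: Lop_parity; exact: (component_mem (parity_direct V)).
rewrite -[component _ _ (Lop n (parity_component v true)) p]/(parity_component _ p).
rewrite !(parity_component_hom _ (pc _)).
by case: p; rewrite ?addr0 ?add0r.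
Qed.

Lemma weight_parity_component k v p : weight k v -> weight k (parity_component v p).
Proof.
move=> kv; have := Lop_parity_component 0 v p.
rewrite [Lop 0 v]kv /parity_component (componentZ (parity_direct V)) => e.
exact: esym.
Qed.

End WeightComponents.

(** * The maps g and A(z) *)

Section OppositeModes.
Variables (R : realType) (V : conformalVertexAlgebra R) (phi : V -> V).
Hypothesis hphi : conj_involution phi.
Implicit Types (u v : V) (i n : int) (k : nat).

Let phiD := conj_linear_morphD (phi_conj_linear hphi).
Let phiZ := conj_linear_morphZ (phi_conj_linear hphi).

Lemma phi_Lop n v : phi (Lop n v) = Lop n (phi v).
Proof. by rewrite /Lop /virasoro (phi_nprod hphi) (phi_cvec hphi). Qed.

Lemma half_weight_phi (k : int) v : half_weight k v -> half_weight k (phi v).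
Proof.
rewrite /half_weight -phi_Lop => ->; rewrite phiZ; congr (_ *: _).
by rewrite fmorph_div /= rmorph_int rmorph_nat.
Qed.

(** Applying phi to phi(1) = phi(1)_(-1) 1 gives 1 = 1_(-1) phi(1) = phi(1). *)
Lemma phi_vac : phi (vac V) = vac V.
Proof.
have e : phi (vac V) = nprod (phi (vac V)) (-1) (vac V) by rewrite nprod_vac.
have := congr1 phi e; rewrite (phi_invol hphi) (phi_nprod hphi) (phi_invol hphi).
by rewrite vac_nprod.
Qed.

Definition gpart k v : V :=
  \sum_(p : bool) phase R k p *: phi (parity_component (weight_component v k) p).

Lemma gpart_conj_linear k : conj_linear (gpart k).
Proof.
move=> c u v; rewrite /gpart scaler_sumr -big_split; apply: eq_bigr => p _.
rewrite /weight_component /parity_component (componentZD (weight_direct_sum V)).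
rewrite (componentZD (parity_direct V)) (phi_conj_linear hphi) scalerDr !scalerA.
by congr (_ *: _ + _); rewrite mulrC.
Qed.

Lemma weight_gpart k v : weight k (gpart k v).
Proof.
have sW := ds_subspace (weight_direct_sum V) (I : [set: nat] k).
apply: subspace_sum => // p _; apply: subspaceZ => //.
apply: (half_weight_phi (k := k)); apply: weight_parity_component.
exact: weight_component_mem.
Qed.

Lemma gpart_eq0 k v : weight_component v k = 0 -> gpart k v = 0.
Proof.
move=> v0; rewrite /gpart v0 big1 // => p _.
rewrite /parity_component (component0 (parity_direct V)) (morph0 phiD).
exact: scaler0.
Qed.

Lemma gmapE v K : (forall k, (K <= k)%N -> weight_component v k = 0) ->
  gmap phi v = \sum_(k < K) gpart k v.
Proof.
by move=> K0; apply: (@fsum_nat _ K (fun k => gpart k v)) => k /K0; exact: gpart_eq0.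
Qed.

Lemma weight_component_gmap v k : weight_component (gmap phi v) k = gpart k v.
Proof.
have [K K0] := weight_component_bound v; rewrite (gmapE K0).
have K1 j : j \notin iota 0 K -> gpart j v = 0.
  by rewrite mem_iota /= add0n -leqNgt => /K0; exact: gpart_eq0.
rewrite /weight_component; move: k.
apply: (component_eq (weight_direct_sum V) (iota_uniq 0 K)) => //.
- by move=> j _; exact: weight_gpart.
- by move=> j [].
- by rewrite -(big_mkord xpredT (gpart^~ v)) /index_iota subn0.
Qed.

Lemma zpow_gmap v i :
  zpow_m2L0 (gmap phi v) i = if i <= 0 then gpart `|i|%N v else 0.
Proof. by case: i => [[|n]|n]; rewrite /zpow_m2L0 ?weight_component_gmap. Qed.

(** The coefficient at z^(i - j) has weight (j - i)/2, and L_1^j lowers it to -(i + j)/2, negative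
    for j > |i|. The bound on j is thus independent of v, which makes additivity of [Acoef]
    immediate. *)
Lemma L1div_zpow_gmap v i j : (`|i| < j)%N ->
  L1div j (zpow_m2L0 (gmap phi v) (i - j%:Z)) = 0.
Proof.
move=> ij; rewrite zpow_gmap; case: ifP => ij0; last first.
  exact: (morph0 (linear_morphD (L1div_linear j))).
by apply: (L1div_eq0 (weight_half (weight_gpart _ _))); lia.
Qed.

Lemma AcoefE v i : Acoef phi v i =
  \sum_(j < `|i|.+1) L1div j (zpow_m2L0 (gmap phi v) (i - j%:Z)).
Proof.
apply: (@fsum_nat _ _ (fun j => L1div j (zpow_m2L0 (gmap phi v) (i - j%:Z)))) => j.
exact: L1div_zpow_gmap.
Qed.

Lemma Acoef_conj_linear i : conj_linear (Acoef phi ^~ i).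
Proof.
move=> c u v; rewrite !AcoefE scaler_sumr -big_split /=; apply: eq_bigr => j _.
rewrite !zpow_gmap; case: ifP => _; first by rewrite gpart_conj_linear L1div_linear.
by rewrite (morph0 (linear_morphD (L1div_linear j))) scaler0 addr0.
Qed.

(** g on vectors of weight k/2 and parity p, both passed as arguments: no decomposition into
    components is involved, and the possibly negative k of a product is allowed. *)
Definition ghom (k : int) p v : V := phase R k p *: phi v.

Lemma half_weight_ghom (k : int) p v : half_weight k v -> half_weight k (ghom k p v).
Proof.
by move=> /half_weight_phi kv; rewrite /half_weight LopZ kv !scalerA mulrC.
Qed.

Lemma parity_ghom (k : int) q p v : parity p v -> parity p (ghom k q v).
Proof.
by move=> /(phi_parity hphi) pv; apply: subspaceZ => //; exact: parity_subspace.
Qed.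

Lemma ghom_nprod (ka kb n : int) p q a b :
  ghom (ka + kb - n - n - 2) (p (+) q) (nprod a n b)
  = - ((-1) ^+ (p && q) * (-1) ^ n) *: nprod (ghom ka p a) n (ghom kb q b).
Proof.
by rewrite /ghom phase_nprod (phi_nprod hphi) nprodZl nprodZr !scalerA.
Qed.

Lemma gpart_hom k p v j : weight k v -> parity p v ->
  gpart j v = if j == k then ghom k p v else 0.
Proof.
move=> kv pv; have [jk|jk] := eqVneq j k; last first.
  by apply: gpart_eq0; rewrite (weight_component_hom _ kv) (negbTE jk).
rewrite /gpart (bigD1 p) //= big1 ?addr0.
  by rewrite (weight_component_hom _ kv) jk eqxx (parity_component_hom _ pv) eqxx.
move=> q qp; rewrite (weight_component_hom _ kv) jk eqxx (parity_component_hom _ pv).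
by rewrite (negbTE qp) (morph0 phiD) scaler0.
Qed.

(** z^(-2 L_0) g(v) is concentrated at z^(-k), so only the power s = i + k of L_1 reaches z^i. *)
Lemma Acoef_hom k p v i : weight k v -> parity p v ->
  Acoef phi v i = if 0 <= i + k%:Z then L1div `|(i + k%:Z)%R|%N (ghom k p v) else 0.
Proof.
move=> kv pv.
have L0 j : L1div j 0 = 0 :> V by exact: (morph0 (linear_morphD (L1div_linear j))).
have zE j : zpow_m2L0 (gmap phi v) (i - j%:Z)
    = if (i - j%:Z == - k%:Z) then ghom k p v else 0.
  rewrite zpow_gmap (gpart_hom _ kv pv).
  have [->|ijk] := eqVneq (i - j%:Z) (- k%:Z); first by rewrite ifT ?ifT //; lia.
  case: ifP => // ij0; rewrite ifF //; lia.
have kw := half_weight_ghom p (weight_half kv).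
rewrite AcoefE; case: ifP => ik; last first.
  by apply: big1 => j _; rewrite zE ifF ?L0 //; lia.
have [ij|ij] := leqP `|(i + k%:Z)%R|%N `|i|%N.
  rewrite (@sum_nat_pick _ `|i|.+1 `|(i + k%:Z)%R|%N
    (fun j => L1div j (zpow_m2L0 (gmap phi v) (i - j%:Z)))) //.
    by rewrite zE ifT //; lia.
  by move=> j jik; rewrite zE ifF ?L0 //; lia.
rewrite big1 => [|j _]; last by rewrite zE ifF ?L0 //; move: (ltn_ord j); lia.
by rewrite (L1div_eq0 kw) //; lia.
Qed.

End OppositeModes.

(** * Opposite modes of arbitrary vectors *)

Section OppositeModule.
Variables (R : realType) (V : conformalVertexAlgebra R) (phi : V -> V).
Hypothesis hphi : conj_involution phi.
Variables (Gamma : set R) (hGamma : subgroup_with_Z Gamma).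
Variables (Ups : set R -> set V) (hUps : graded_mod_Z Gamma Ups).
Hypothesis hUpsL : Ups (Zcoset 0) (cvec V).
Hypothesis hUpsphi : forall gamma v, Gamma gamma ->
  Ups (Zcoset gamma) v -> Ups (Zcoset gamma) (phi v).
Variables (M : lmodType R[i]) (parM : bool -> set M) (Y : V -> R -> M -> M).
Hypothesis hM : twisted_module Gamma Ups parM Y.
Implicit Types (a b u v : V) (x y : M) (p q : bool) (k : nat).

Let YD m x := YDl hM m x.

(** V^[ga] is the sum of its even and odd parts, and each part is L_0-stable, so [weight_ind]
    applies inside it. *)
Lemma homogeneous_ind_Ups ga (P : V -> Prop) : Gamma ga -> P 0 ->
  (forall u v, P u -> P v -> P (u + v)) ->
  (forall k p v, Ups (Zcoset ga) v -> weight k v -> parity p v -> P v) ->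
  forall v, Ups (Zcoset ga) v -> P v.
Proof.
move=> gaG P0 PD Ph v gav; have Usub := Ups_subspace hUps gaG.
have hom p u : Ups (Zcoset ga) u -> parity p u -> P u.
  move=> gau pu; apply: (@weight_ind _ V (Ups (Zcoset ga) `&` parity p)) => //.
  - have pS := parity_subspace V p.
    split=> [|c w z [? ?] [? ?]]; first by split; apply: subspace0.
    by split; apply: subspaceZD.
  - move=> w [gaw pw]; split; last exact: Lop_parity.
    exact: (Ups_L0 hUps gaG gaw).
  - by move=> k w [gaw pw] kw; exact: (Ph k p).
have [_ /(_ v gav)[v0 [v1 [pv0 pv1 gav0 gav1 ->]]]] := Ups_super hUps gaG.
by apply: PD; [exact: (hom false)|exact: (hom true)].
Qed.

Lemma homogeneous_ind (P : V -> Prop) : P 0 ->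
  (forall u v, P u -> P v -> P (u + v)) ->
  (forall ga k p v, Gamma ga -> Ups (Zcoset ga) v -> weight k v -> parity p v ->
     P v) ->
  forall v, P v.
Proof.
move=> P0 PD Ph; apply: (direct_sum_ind (Ups_direct hUps)) => // X v [ga gaG <-].
by apply: (homogeneous_ind_Ups gaG) => // k p u gau; exact: Ph gau.
Qed.

(** A(z) v is a Laurent polynomial: for v of weight k/2 its exponents s - k lie between -k and -k/2,
    since L_1^s g(v) = 0 for 2 s > k. *)
Lemma Acoef_bound v : exists N, forall i : int, (N <= `|i|)%N -> Acoef phi v i = 0.
Proof.
move: v; apply: homogeneous_ind.
- by exists 0%N => i _; exact: (morph0 (conj_linear_morphD (Acoef_conj_linear hphi i))).
- move=> u v [N NP] [N' N'P]; exists (maxn N N') => i.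
  rewrite geq_max => /andP[Ni N'i].
  by rewrite (conj_linear_morphD (Acoef_conj_linear hphi i)) NP ?N'P ?addr0.
move=> ga k p v _ _ kv pv; exists k.+1 => i ki.
rewrite (Acoef_hom hphi _ kv pv); case: ifP => // ik0.
by rewrite (L1div_eq0 (half_weight_ghom hphi p (weight_half kv))) //; lia.
Qed.

Lemma opp_modeE v n x N : (forall i : int, (N <= `|i|)%N -> Acoef phi v i = 0) ->
  opp_mode phi Y v n x
  = \sum_(i <- int_range N) Y (Acoef phi v i) (- n - 2 - i%:~R) x.
Proof.
move=> N0; apply: (@fsum_int _ N (fun i => Y (Acoef phi v i) (- n - 2 - i%:~R) x)) => i.
by move=> /N0 ->; exact: (Y0l hM).
Qed.

Lemma opp_mode_conj_linear n x : conj_linear (fun v => opp_mode phi Y v n x).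
Proof.
move=> c u v; have [N NP] := Acoef_bound u; have [N' N'P] := Acoef_bound v.
have [K [uK vK]] : exists K, (forall i : int, (K <= `|i|)%N -> Acoef phi u i = 0) /\
    (forall i : int, (K <= `|i|)%N -> Acoef phi v i = 0).
  exists (maxn N N'); split=> i; rewrite geq_max => /andP[Ni N'i].
    exact: NP.
  exact: N'P.
rewrite (opp_modeE _ _ uK) (opp_modeE _ _ vK) (@opp_modeE _ n x K); last first.
  by move=> i Ki; rewrite (Acoef_conj_linear hphi i c u v) uK ?vK ?scaler0 ?addr0.
rewrite scaler_sumr -big_split /=; apply: eq_bigr => i _.
by rewrite (Acoef_conj_linear hphi i c u v) YD (YZl hM).
Qed.

Lemma opp_modeDl n x : {morph (fun v => opp_mode phi Y v n x) : u v / u + v}.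
Proof. exact: conj_linear_morphD (opp_mode_conj_linear n x). Qed.

Lemma opp_mode0l n x : opp_mode phi Y 0 n x = 0.
Proof. exact: (morph0 (opp_modeDl n x)). Qed.

Lemma opp_mode_linear v n : linear (opp_mode phi Y v n).
Proof.
move=> c x y; have [N NP] := Acoef_bound v; rewrite !(opp_modeE _ _ NP).
rewrite scaler_sumr -big_split /=; apply: eq_bigr => i _.
exact: (tm_linearr hM).
Qed.

Lemma opp_modeDr v n : {morph opp_mode phi Y v n : x y / x + y}.
Proof. exact: linear_morphD (opp_mode_linear v n). Qed.

Lemma opp_mode_weight k p v n x : weight k v -> parity p v ->
  opp_mode phi Y v n x = opp_mode_hw Y k (ghom phi k p v) n x.
Proof.
move=> kv pv.
rewrite /opp_mode (@fsum_seq _ _ [seq s%:Z - k%:Z | s <- iota 0 k.+1]).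
- rewrite big_map -[iota 0 k.+1]/(index_iota 0 k.+1) big_mkord.
  apply: eq_bigr => s _; rewrite (Acoef_hom hphi _ kv pv) subrK.
  by congr Y; rewrite ?absz_nat // intrB; ring.
- by rewrite map_inj_uniq ?iota_uniq // => i j /addIr[].
move=> i ik; rewrite (Acoef_hom hphi _ kv pv); case: ifP => [i0|_]; last exact: (Y0l hM).
rewrite (L1div_eq0 (half_weight_ghom hphi p (weight_half kv))); first exact: (Y0l hM).
have [//|le] := ltP; case/negP: ik; apply/mapP; exists `|(i + k%:Z)%R|%N; last by lia.
by rewrite mem_iota; lia.
Qed.

(** Extends [opp_mode_weight] to negative k, where both sides are zero; needed for a_(n+j) b, whose
    weight becomes negative as j grows. *)
Lemma opp_mode_half_weight (k : int) p v n x : half_weight k v -> parity p v ->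
  opp_mode phi Y v n x = opp_mode_hw Y k (ghom phi k p v) n x.
Proof.
case: k => k kv pv; first exact: opp_mode_weight.
rewrite (half_weight_lt0 _ kv) // opp_mode0l /opp_mode_hw big1 // => s _.
rewrite /ghom (morph0 (conj_linear_morphD (phi_conj_linear hphi))) scaler0.
by rewrite (morph0 (linear_morphD (L1div_linear _))) (Y0l hM).
Qed.

Lemma Ups_ghom ga (k : int) p v : Gamma ga -> Ups (Zcoset ga) v ->
  Ups (Zcoset ga) (ghom phi k p v).
Proof.
by move=> gaG gav; apply: subspaceZ; [exact: (Ups_subspace hUps gaG)|exact: hUpsphi].
Qed.

(** The modes involved have index k - 2 - n - s, which lies in ga + Z exactly when n lies in -ga +
    Z. This is the origin of the opposite grading. *)
Lemma opp_mode_index ga a n x : Gamma ga -> Ups (Zcoset ga) a ->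
  ~ Zcoset (- ga) n -> opp_mode phi Y a n x = 0.
Proof.
move=> gaG + ngan; move: a; apply: (homogeneous_ind_Ups gaG).
- exact: opp_mode0l.
- by move=> u v u0 v0; rewrite opp_modeDl u0 v0 addr0.
move=> k p v gav kv pv; rewrite (opp_mode_weight _ _ kv pv) /opp_mode_hw big1 // => s _.
apply: (tm_modes hM x gaG (Ups_L1div hGamma hUps hUpsL s gaG (Ups_ghom k p gaG gav))).
move=> gan; apply: ngan; have := ZcosetN (Zcoset_addz (- k%:Z + 2 + s%:Z) gan).
by congr (Zcoset _ _); rewrite !intrD intrN; ring.
Qed.

Lemma opp_mode_parity p q a n x : parity p a -> parM q x ->
  parM (p (+) q) (opp_mode phi Y a n x).
Proof.
move=> + qx; have sub r := ds_subspace (tm_parity_direct hM) (I : [set: bool] r).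
move: a; apply: (weight_ind (parity_subspace V p)).
- by move=> v; exact: Lop_parity.
- by rewrite opp_mode0l; exact: subspace0.
- by move=> u v pu pv; rewrite opp_modeDl; exact: subspaceD.
move=> k v pv kv; rewrite (opp_mode_weight _ _ kv pv).
apply: subspace_sum => // s _; apply: (tm_parity hM) => //.
by apply: L1div_parity; exact: parity_ghom.
Qed.

Lemma opp_mode_vac n x : opp_mode phi Y (vac V) n x = if n == -1 then x else 0.
Proof.
have kv : weight 0 (vac V) by apply/weight0; exists 1; rewrite scale1r.
rewrite (opp_mode_weight _ _ kv (vac_even V)) /opp_mode_hw /= big_ord1 L1div0.
rewrite /ghom (phi_vac hphi) /phase !mul0r addr0 mulr0 oppr0 expi0 scale1r (tm_vac hM).
by congr (if _ then _ else _); apply/eqP/eqP => [|->]; lra.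
Qed.

(** The compositions appear in reversed order, ready for pairing with a functional. Both sides are
    additive in a and in b, so two inductions reduce to [opp_mode_hw_borcherds] for g a and g b. *)
Lemma opp_mode_borcherds p q ga gb a b (m k : R) (n : int) x :
  Gamma ga -> Gamma gb -> Ups (Zcoset ga) a -> Ups (Zcoset gb) b ->
  parity p a -> parity q b -> Zcoset ga (- m) -> Zcoset gb (- k) ->
  exists N0, forall N, (N0 <= N)%N ->
  \sum_(j < N) gbinom m%:C j *:
    opp_mode phi Y (nprod a (n + j%:Z) b) (m + k - j%:R) x
  = \sum_(j < N) ((-1) ^+ j * gbinom n%:~R j) *:
    (opp_mode phi Y b (k + j%:R) (opp_mode phi Y a (m + n%:~R - j%:R) x)
     - ((-1) ^+ (p && q) * (-1) ^ n) *:
       opp_mode phi Y a (m + j%:R) (opp_mode phi Y b (k + n%:~R - j%:R) x)).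
Proof.
move=> gaG gbG gaa gbb pa qb gam gbk.
pose P u v := exists N0, forall N, (N0 <= N)%N ->
  \sum_(j < N) gbinom m%:C j *:
    opp_mode phi Y (nprod u (n + j%:Z) v) (m + k - j%:R) x
  = \sum_(j < N) ((-1) ^+ j * gbinom n%:~R j) *:
    (opp_mode phi Y v (k + j%:R) (opp_mode phi Y u (m + n%:~R - j%:R) x)
     - ((-1) ^+ (p && q) * (-1) ^ n) *:
       opp_mode phi Y u (m + j%:R) (opp_mode phi Y v (k + n%:~R - j%:R) x)).
have opp0 v' n' : opp_mode phi Y v' n' 0 = 0 by exact: (morph0 (opp_modeDr v' n')).
have sub r g : Gamma g -> Defs.subspace (Ups (Zcoset g) `&` @parity R V r).
  move=> gG; have gS := Ups_subspace hUps gG; have rS := parity_subspace V r.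
  split=> [|c w z [? ?] [? ?]]; first by split; apply: subspace0.
  by split; apply: subspaceZD.
have stab r g : Gamma g -> forall v, (Ups (Zcoset g) `&` @parity R V r) v ->
    (Ups (Zcoset g) `&` @parity R V r) (Lop 0 v).
  move=> gG v [gv rv]; split; last exact: Lop_parity.
  exact: (Ups_L0 hUps gG gv).
suff: P a b by [].
have Hb : forall ka a', Ups (Zcoset ga) a' -> parity p a' -> weight ka a' -> P a' b.
  move=> ka a' gaa' pa' wa'.
  move: (conj gbb qb : (Ups (Zcoset gb) `&` @parity R V q) b); move: b {gbb qb}.
  apply: (weight_ind (sub q gb gbG) (stab q gb gbG)).
  - exists 0%N => N _; rewrite !big1 // => j _.
      by rewrite !opp_mode0l opp0 scaler0 subr0 scaler0.
    by rewrite nprod0r opp_mode0l scaler0.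
  - move=> u v [N NP] [N' N'P]; exists (maxn N N') => K; rewrite geq_max => /andP[NK N'K].
    under eq_bigr => j _ do rewrite nprodDr opp_modeDl scalerDr.
    rewrite big_split /= NP // N'P // -big_split /=; apply: eq_bigr => j _.
    rewrite -scalerDr; congr (_ *: _); rewrite !opp_modeDl opp_modeDr scalerDr.
    by rewrite opprD !addrA; congr (_ + _); rewrite addrAC.
  move=> kb b [gbb qb] wb.
  have wa2 := half_weight_ghom hphi p (weight_half wa').
  have wb2 := half_weight_ghom hphi q (weight_half wb).
  have [N0 N0P] := opp_mode_hw_borcherds hGamma hUps hUpsL hM n x gaG gbG
    (Ups_ghom ka p gaG gaa') (Ups_ghom kb q gbG gbb)
    (parity_ghom hphi ka p pa') (parity_ghom hphi kb q qb) wa2 wb2 gam gbk.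
  exists N0 => N NN0; have {N0P NN0} := N0P N NN0.
  set sg := (-1) ^+ (p && q) * (-1) ^ n => E.
  have sgsg : sg * sg = 1 :> R[i].
    by rewrite /sg mulrACA signz_sqr mulr1 -expr2 sqrr_sign.
  (* g (a_(n+j) b) yields the factor - sg (-1)^j. Since sg^2 = 1, multiplying by - sg exchanges the
     two terms of each bracket on the right. *)
  transitivity (- sg *: \sum_(j < N) ((-1) ^+ j * gbinom m%:C j) *:
    opp_mode_hw Y (ka%:Z + kb%:Z - (n + j%:Z) - (n + j%:Z) - 2)
      (nprod (ghom phi ka p a') (n + j%:Z) (ghom phi kb q b)) (m + k - j%:R) x).
    rewrite scaler_sumr; apply: eq_bigr => j _.
    rewrite (opp_mode_half_weight _ _
      (half_weight_nprod _ pa' (weight_half wa') (weight_half wb))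
      (nprod_parity _ pa' qb)).
    rewrite (ghom_nprod hphi) /opp_mode_hw scalerA !scaler_sumr.
    apply: eq_bigr => s _.
    rewrite (linear_morphZ (L1div_linear s)) (YZl hM) !scalerA; congr (_ *: _).
    rewrite /sg expfzDr; last by rewrite oppr_eq0 oner_eq0.
    by rewrite -exprnP; ring.
  rewrite E scaler_sumr; apply: eq_bigr => j _.
  set A := _ - _; set B := _ - _.
  rewrite scalerA [- sg * _]mulrC -[LHS]scalerA; congr (_ *: _).
  rewrite /A /B scalerBr !scaleNr scalerA sgsg scale1r opprK addrC.
  by rewrite !(opp_mode_weight _ _ wa' pa') !(opp_mode_weight _ _ wb qb).
move: (conj gaa pa : (Ups (Zcoset ga) `&` @parity R V p) a); move: {gaa pa} a.
apply: (weight_ind (sub p ga gaG) (stab p ga gaG)).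
- exists 0%N => N _; rewrite !big1 // => j _.
    by rewrite !opp_mode0l opp0 scaler0 subr0 scaler0.
  by rewrite nprod0l opp_mode0l scaler0.
- move=> u v [N NP] [N' N'P]; exists (maxn N N') => K; rewrite geq_max => /andP[NK N'K].
  under eq_bigr => j _ do rewrite nprodDl opp_modeDl scalerDr.
  rewrite big_split /= NP // N'P // -big_split /=; apply: eq_bigr => j _.
  rewrite -scalerDr; congr (_ *: _); rewrite !opp_modeDl opp_modeDr scalerDr.
  by rewrite opprD !addrA; congr (_ + _); rewrite addrAC.
by move=> ka a [gaa pa] wa; exact: (Hb ka).
Qed.

Variables (grM : R -> set M) (hgrM : positive_energy Gamma Ups parM Y grM).

Lemma gr_subspace j : Defs.subspace (grM j).
Proof. by case: (pe_super hgrM j). Qed.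

(** The s-th summand has weight k/2 - s and index k - 2 - n - s, so its degree shift does not depend
    on s. The shift is opposite to that of the mode a_(n) on M. *)
Lemma opp_mode_gr ga k p a n j x : Gamma ga -> Ups (Zcoset ga) a -> weight k a ->
  parity p a -> grM j x -> grM (j + n + 1 - k%:R / 2) (opp_mode phi Y a n x).
Proof.
move=> gaG gaa ka pa jx; have sG := gr_subspace.
have [gan|gan] := pselect (Zcoset (- ga) n); last first.
  by rewrite (opp_mode_index _ gaG gaa gan); exact: subspace0.
rewrite (opp_mode_weight _ _ ka pa); apply: subspace_sum => // s _.
have gag := Ups_L1div hGamma hUps hUpsL s gaG (Ups_ghom k p gaG gaa).
have kg := half_weight_L1div s (half_weight_ghom hphi p (weight_half ka)).
have [s2|s2] := leqP (s + s) k; last first.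
  rewrite (L1div_eq0 (half_weight_ghom hphi p (weight_half ka))); last by lia.
  by rewrite (Y0l hM); exact: subspace0.
have kg' : weight (k - (s + s))%N (L1div s (ghom phi k p a)).
  by move: kg; rewrite /half_weight (_ : k%:Z - s%:Z - s%:Z = (k - (s + s))%N%:Z) //; lia.
have gn : Zcoset (ga - (k - (s + s))%N%:R / 2) (- n - 1 + k%:R / 2).
  have := ZcosetN gan; rewrite opprK => -[i _ e].
  exists (i - 1 + k%:Z - s%:Z) => //.
  by rewrite natrB // natrD !intrD !intrN -[k%:~R]/(k%:R) -[s%:~R]/(s%:R) -e; field.
have := pe_modes hgrM gaG gag kg' gn jx.
by congr (grM _ (Y _ _ _)); rewrite ?natrB // ?natrD -?[k%:~R]/(k%:R); field.
Qed.

End OppositeModule.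

(** * The opposite grading *)

Section OppositeGrading.
Variables (R : realType) (V : conformalVertexAlgebra R).
Variables (Gamma : set R) (hGamma : subgroup_with_Z Gamma).
Variables (Ups : set R -> set V) (hUps : graded_mod_Z Gamma Ups).

Lemma image_oppK : involutive (fun X : set R => [set - x | x in X]).
Proof.
move=> X; apply/seteqP; split => [x [_ [y Xy <-] <-]|x Xx]; first by rewrite opprK.
by exists (- x); [exists x|rewrite opprK].
Qed.

Lemma image_opp_Zcoset (x : R) : [set - y | y in Zcoset x] = Zcoset (- x).
Proof.
apply/seteqP; split => [_ [y xy <-]|y xy]; first exact: ZcosetN.
by exists (- y); [rewrite -[x]opprK; exact: ZcosetN|rewrite opprK].
Qed.

Lemma opp_grading_Zcoset x : opp_grading Ups (Zcoset x) = Ups (Zcoset (- x)).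
Proof. by rewrite /opp_grading image_opp_Zcoset. Qed.

Lemma direct_sum_reindex (U : lmodType R[i]) (I : choiceType) (D : set I)
  (F : I -> set U) (h : I -> I) : involutive h -> (forall i, D i -> D (h i)) ->
  direct_sum D F -> direct_sum D (F \o h).
Proof.
move=> hK Dh dF; split=> [i Di|v]; first by apply: (ds_subspace dF); exact: Dh.
have reindex (G : I -> set U) x : decomposes D G v x -> decomposes D (G \o h) v (x \o h).
  move=> [xG x0 xfin vx]; split=> [i Di|i Di||].
  - by apply: xG; exact: Dh.
  - by apply: x0 => /Dh; rewrite hK.
  - have -> : [set i | (x \o h) i != 0] = h @` [set i | x i != 0].
      apply/seteqP; split => [i xi|_ [i xi <-]] /=; last by rewrite hK.
      by exists (h i); rewrite ?hK.
    exact: finite_image.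
  - by rewrite {1}vx; apply: reindex_fsbigT; exact: inv_bij.
exists (component D F v \o h); split; first by apply: reindex; exact: (componentP dF).
move=> x /reindex xP; rewrite -(@component_unique _ _ _ _ _ dF v (x \o h)).
  by apply/funext => i /=; rewrite hK.
by move: xP; congr decomposes; apply/funext => i /=; rewrite hK.
Qed.

Lemma opp_graded_mod_Z : graded_mod_Z Gamma (opp_grading Ups).
Proof.
have GN := GammaN hGamma.
split.
- by move=> g gG; rewrite opp_grading_Zcoset; apply: (Ups_super hUps); exact: GN.
- apply: (direct_sum_reindex image_oppK _ (Ups_direct hUps)) => X [g gG <-].
  by exists (- g); [exact: GN|rewrite image_opp_Zcoset].
- move=> g h a n b gG hG; rewrite !opp_grading_Zcoset opprD.
  by apply: (Ups_nprod hUps); exact: GN.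
- by move=> g v gG; rewrite opp_grading_Zcoset; apply: (Ups_L0 hUps); exact: GN.
Qed.

End OppositeGrading.

(** * The restricted dual as a graded superspace *)

Section RestrictedDuals.
Variables (R : realType) (M : lmodType R[i]) (grM : R -> set M).
Implicit Types (f g : rdual grM) (x y : M).

Lemma rdual_ext f g : (forall x, f x = g x) -> f = g.
Proof. by move=> fg; apply: val_inj; apply/funext. Qed.

Lemma rdual_addE f g x : (f + g) x = f x + g x.
Proof. by []. Qed.

Lemma rdual_scaleE (c : R[i]) f x : (c *: f) x = c * f x.
Proof. by []. Qed.

Lemma rdual_0E x : (0 : rdual grM) x = 0.
Proof. by []. Qed.

Lemma rdual_oppE f x : (- f) x = - f x.
Proof. by []. Qed.

Lemma rdual_sumE (J : Type) (r : seq J) (P : pred J) (F : J -> rdual grM) x :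
  (\sum_(j <- r | P j) F j) x = \sum_(j <- r | P j) F j x.
Proof. exact: (big_morph (fun f => f x) (fun f g => rdual_addE f g x)). Qed.

Lemma rdual_conj_linear f : conj_linear f.
Proof. by have /asboolP[] : pairing f \in rdual_pred grM by case: f. Qed.

Lemma rdualDr f : {morph f : x y / x + y}.
Proof. exact: conj_linear_morphD (rdual_conj_linear f). Qed.

Lemma rdualZr f (c : R[i]) x : f (c *: x) = c^* * f x.
Proof. exact: (conj_linear_morphZ (rdual_conj_linear f)). Qed.

Lemma rdual0r f : f 0 = 0.
Proof. exact: (morph0 (rdualDr f)). Qed.

Lemma rdual_support f : finite_set [set n | exists2 x, grM n x & f x <> 0].
Proof. by have /asboolP[] : pairing f \in rdual_pred grM by case: f. Qed.

Lemma rdual_exists (h : M -> R[i]^o) : conj_linear h ->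
  finite_set [set n | exists2 x, grM n x & h x <> 0] ->
  exists f, forall x, f x = h x.
Proof.
move=> hl hf; have hP : h \in rdual_pred grM by apply/asboolP.
by exists (RDual hP).
Qed.

Lemma rdual_comp f (h : M -> M) : linear h ->
  (forall n x, grM n x -> grM n (h x)) ->
  exists g, forall x, g x = f (h x).
Proof.
move=> hl hgr; apply: (@rdual_exists (fun x => f (h x))).
  by move=> c x y; rewrite hl rdual_conj_linear.
apply: sub_finite_set (rdual_support f) => n [x nx fx].
by exists (h x) => //; exact: hgr.
Qed.

Hypothesis dM : direct_sum [set: R] grM.
Local Notation cM := (component [set: R] grM).

Lemma rdual_gr_component f n x : rdual_gr n f -> f x = f (cM x n).
Proof.
move=> nf; move: x; apply: (direct_sum_ind dM).
- by rewrite (component0 dM).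
- by move=> x y fx fy; rewrite (componentD dM) !rdualDr fx fy.
move=> j x _ jx; rewrite (component_hom dM _ jx) //.
by case: eqP => // nj; rewrite rdual0r; apply: (nf j) => // jn; exact: nj.
Qed.

Lemma rdual_gr_proj f n : exists g, rdual_gr n g /\ forall x, g x = f (cM x n).
Proof.
have [|g gE] := @rdual_comp f (fun x => cM x n) (fun c x y => componentZD dM c x y n).
  move=> j x jx; rewrite (component_hom dM _ jx) //; case: eqP => // _.
  exact: (subspace0 (ds_subspace dM I)).
exists g; split=> // j x jn jx; rewrite gE (component_neq dM _ jx) ?rdual0r //.
by apply/eqP => nj; exact: jn.
Qed.

Lemma rdual_gr_subspace n : Defs.subspace (@rdual_gr R M grM n).
Proof.
split=> [j x _ _|c f g nf ng j x jn jx]; first exact: rdual_0E.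
by rewrite rdual_addE rdual_scaleE (nf j) // (ng j) // mulr0 addr0.
Qed.

(** The components of f are its composites with the projections onto the M_n, finitely many nonzero
    by the support condition. A functional of degree n sees only the component x_n, which gives
    uniqueness. *)
Lemma rdual_gr_direct : direct_sum [set: R] (@rdual_gr R M grM).
Proof.
split=> [n _|f]; first exact: rdual_gr_subspace.
pose proj n := projT1 (cid (rdual_gr_proj f n)).
have projP n : rdual_gr n (proj n) /\ forall x, proj n x = f (cM x n).
  by rewrite /proj; case: (cid _).
have /finite_seqP[r rE] := rdual_support f.
have r0 n : n \notin undup r -> proj n = 0.
  rewrite mem_undup => nr; apply: rdual_ext => x; rewrite (projP n).2 rdual_0E.
  apply: contrapT => fx; move/negP: nr; apply.
  have : [set` r] n by rewrite -rE; exists (cM x n) => //; exact: (component_mem dM).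
  by [].
exists proj; split=> [|x' [x'gr _ x'fin fE]].
  split=> //.
  - by move=> n _; exact: (projP n).1.
  - by move=> n [].
  - apply: (@sub_finite_set _ _ [set` undup r]); last exact: finite_seq.
    by move=> n /=; apply: contraNT => /r0 ->.
  rewrite (fsum_seq (undup_uniq r) r0); apply: rdual_ext; apply: (direct_sum_ind dM).
  - by rewrite !rdual0r.
  - by move=> x y fx fy; rewrite !rdualDr fx fy.
  move=> j x _ jx; rewrite rdual_sumE.
  have pj n : proj n x = if n == j then f x else 0.
    by rewrite (projP n).2 (component_hom dM _ jx) //; case: eqP => // _; rewrite rdual0r.
  have [jr|jr] := boolP (j \in undup r).
    rewrite (bigD1_seq j) ?undup_uniq //= pj eqxx big1 ?addr0 // => n nj.
    by rewrite pj (negbTE nj).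
  have fx0 : f x = 0 by have := pj j; rewrite eqxx (r0 _ jr) => <-.
  by rewrite fx0 big1 // => n _; rewrite pj fx0 if_same.
apply/funext => n; apply: rdual_ext => x; rewrite (projP n).2.
have /finite_seqP[s sE] := x'fin.
have s0 j : j \notin undup s -> x' j = 0.
  rewrite mem_undup => js; apply/eqP; apply: contraNT js => xj.
  by have : [set` s] j by rewrite -sE.
have hom j : x' j (cM x n) = if j == n then x' n x else 0.
  case: eqP => [->|jn]; first by rewrite -(rdual_gr_component _ (x'gr n I)).
  apply: (x'gr j I n); first by move=> nj; exact: jn.
  exact: (component_mem dM).
rewrite {1}fE (fsum_seq (undup_uniq s) s0) rdual_sumE.
have [ns|ns] := boolP (n \in undup s).
  rewrite (bigD1_seq n) ?undup_uniq //= hom eqxx big1 ?addr0 // => j nj.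
  by rewrite hom (negbTE nj).
rewrite (s0 _ ns) rdual_0E big1 // => j _; rewrite hom; case: eqP => // _.
by rewrite (s0 _ ns) rdual_0E.
Qed.

Variable parM : bool -> set M.
Hypothesis dP : direct_sum [set: bool] parM.
Hypothesis sP : forall j, super_subspace parM (grM j).
Local Notation cP := (component [set: bool] parM).

(** Parity projections preserve degrees, so composing with them does not enlarge the support of a
    functional. *)
Lemma component_par_gr n x p : grM n x -> grM n (cP x p).
Proof.
move=> nx; have [_ /(_ x nx)[x0 [x1 [p0 p1 g0 g1 ->]]]] := sP n.
rewrite (componentD dP) (component_hom dP I p0) (component_hom dP I p1).
by case: p; rewrite ?add0r ?addr0.
Qed.

Lemma rdual_par_component f p x : rdual_par parM p f -> f x = f (cP x p).
Proof.
move=> pf; move: x; apply: (direct_sum_ind dP).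
- by rewrite (component0 dP).
- by move=> x y fx fy; rewrite (componentD dP) !rdualDr fx fy.
move=> q x _ qx; rewrite (component_hom dP I qx).
case: eqP => // pq; rewrite rdual0r; apply: pf; move: qx pq.
by case: p; case: q.
Qed.

Lemma rdual_par_proj f p : exists g, rdual_par parM p g /\ forall x, g x = f (cP x p).
Proof.
have [|g gE] := @rdual_comp f (fun x => cP x p) (fun c x y => componentZD dP c x y p).
  by move=> n x; exact: component_par_gr.
exists g; split=> // x px; rewrite gE (component_neq dP I px) ?rdual0r //.
by case: p {gE px}.
Qed.

Lemma rdual_par_subspace p : Defs.subspace (@rdual_par R M grM parM p).
Proof.
split=> [x _|c f g pf pg x px]; first exact: rdual_0E.
by rewrite rdual_addE rdual_scaleE pf // pg // mulr0 addr0.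
Qed.

Lemma component_par_sum x : x = cP x false + cP x true.
Proof.
rewrite {1}(@component_sum _ _ _ _ _ dP x [:: false; true]) //.
  by rewrite big_cons big_seq1.
by case.
Qed.

Lemma rdual_par_direct : direct_sum [set: bool] (@rdual_par R M grM parM).
Proof.
split=> [p _|f]; first exact: rdual_par_subspace.
pose proj p := projT1 (cid (rdual_par_proj f p)).
have projP p : rdual_par parM p (proj p) /\ forall x, proj p x = f (cP x p).
  by rewrite /proj; case: (cid _).
have sumb (x' : bool -> rdual grM) : \sum_(i \in [set: bool]) x' i = x' false + x' true.
  rewrite (@fsum_seq _ _ [:: false; true]) ?big_cons ?big_nil ?addr0 //.
  by case.
exists proj; split=> [|x' [x'P _ _ fE]].
  split=> //.
  - by move=> p _; exact: (projP p).1.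
  - by move=> p [].
  - apply: (@sub_finite_set _ _ [set` [:: false; true]]); first by case.
    exact: finite_seq.
  rewrite sumb; apply: rdual_ext => x.
  by rewrite rdual_addE !(projP _).2 -rdualDr -component_par_sum.
apply/funext => p; apply: rdual_ext => x; rewrite (projP p).2 fE sumb rdual_addE.
have hom q : x' q (cP x p) = if q == p then x' p x else 0.
  case: eqP => [->|qp]; first by rewrite -(rdual_par_component _ (x'P p I)).
  apply: (x'P q I); have := component_mem dP x (I : [set: bool] p).
  by case: p q qp => -[].
by rewrite !hom; case: p {hom} => /=; rewrite ?addr0 ?add0r.
Qed.

Lemma rdual_gr_super n : super_subspace (@rdual_par R M grM parM) (@rdual_gr R M grM n).
Proof.
split=> [|f nf]; first exact: rdual_gr_subspace.
have [f0 [f0P f0E]] := rdual_par_proj f false.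
have [f1 [f1P f1E]] := rdual_par_proj f true.
exists f0, f1; split=> //.
- by move=> j x jn jx; rewrite f0E; apply: (nf j) => //; exact: component_par_gr.
- by move=> j x jn jx; rewrite f1E; apply: (nf j) => //; exact: component_par_gr.
by apply: rdual_ext => x; rewrite rdual_addE f0E f1E -rdualDr -component_par_sum.
Qed.

End RestrictedDuals.

(** * The contragredient module and its energy grading *)

Section Contragredient.
Variables (R : realType) (V : conformalVertexAlgebra R) (phi : V -> V).
Hypothesis hphi : conj_involution phi.
Variables (Gamma : set R) (hGamma : subgroup_with_Z Gamma).
Variables (Ups : set R -> set V) (hUps : graded_mod_Z Gamma Ups).
Hypothesis hUpsL : Ups (Zcoset 0) (cvec V).
Hypothesis hUpsphi : forall gamma v, Gamma gamma ->
  Ups (Zcoset gamma) v -> Ups (Zcoset gamma) (phi v).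
Variables (M : lmodType R[i]) (parM : bool -> set M) (Y : V -> R -> M -> M).
Hypothesis hM : twisted_module Gamma Ups parM Y.
Variables (grM : R -> set M) (hgrM : positive_energy Gamma Ups parM Y grM).
Implicit Types (f : rdual grM) (x : M) (v : V).

Lemma finite_set_ubound (S : set R) : finite_set S ->
  exists d, forall s, S s -> s <= d.
Proof.
move=> /finite_seqP[r ->]; elim: r => [|s r [d dP]]; first by exists 0.
exists (Num.max s d) => t; rewrite /= inE le_max => /orP[/eqP ->|/dP ->].
  by rewrite lexx.
by rewrite orbT.
Qed.

Let hom_ind := homogeneous_ind hUps.

(** The point is finite support: for homogeneous v the opposite mode shifts degrees by a constant,
    so the new support lies in a translate of that of f. *)
Lemma contragredient_exists v n f :
  exists g : rdual grM, forall x, g x = f (opp_mode phi Y v n x).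
Proof.
apply: (@rdual_exists _ _ _ (fun x => f (opp_mode phi Y v n x))).
  by move=> c x y; rewrite (opp_mode_linear hphi hUps hM) rdual_conj_linear.
move: v; apply: hom_ind.
- apply: (@sub_finite_set _ _ set0) => // j [x _].
  by rewrite (opp_mode0l hphi hUps hM) rdual0r.
- move=> u v uf vf; have fin := conj uf vf; rewrite -finite_setU in fin.
  apply: sub_finite_set fin => j [x jx].
  rewrite (opp_modeDl hphi hUps hM) rdualDr => uv.
  have [fu|fu] := pselect (f (opp_mode phi Y u n x) = 0); last by left; exists x.
  by right; exists x => // fv; apply: uv; rewrite fu fv addr0.
move=> ga k p v gaG gav kv pv.
have fin := finite_image (fun d => d - n - 1 + k%:R / 2) (rdual_support f).
apply: sub_finite_set fin => j [x jx fx].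
exists (j + n + 1 - k%:R / 2); last by field.
exists (opp_mode phi Y v n x) => //.
exact: (opp_mode_gr hphi hGamma hUps hUpsL hUpsphi hM hgrM n gaG gav kv pv jx).
Qed.

Definition dual_mode v n f : rdual grM := projT1 (cid (contragredient_exists v n f)).

Lemma dual_modeE : contragredient phi Y dual_mode.
Proof. by move=> v n f x; rewrite /dual_mode; case: (cid _). Qed.

(** Two conjugations cancel: [opp_mode] is conjugate linear in v through g, and f is conjugate
    linear in its argument. *)
Lemma dual_mode_linearl n f : linear (fun v => dual_mode v n f).
Proof.
move=> c u v; apply: rdual_ext => x.
rewrite rdual_addE rdual_scaleE !dual_modeE.
rewrite (opp_mode_conj_linear hphi hUps hM n x c u v) rdualDr rdualZr.
by rewrite conjCK.
Qed.

Lemma dual_mode_linearr v n : linear (dual_mode v n).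
Proof.
move=> c f g; apply: rdual_ext => x.
by rewrite rdual_addE rdual_scaleE !dual_modeE.
Qed.

(** Positivity of the energy enters here. If f vanishes above degree d and x has degree j >= 0, the
    opposite mode of index n >= d + k/2 sends x to degree j + n + 1 - k/2 > d. *)
Lemma dual_mode_field v f : exists N : R, forall n, N <= n -> dual_mode v n f = 0.
Proof.
move: v; apply: hom_ind.
- by exists 0 => n _; exact: (morph0 (linear_morphD (dual_mode_linearl n f))).
- move=> u v [N NP] [N' N'P]; exists (Num.max N N') => n; rewrite ge_max => /andP[Nn N'n].
  by rewrite (linear_morphD (dual_mode_linearl n f)) NP // N'P // addr0.
move=> ga k p v gaG gav kv pv.
have [d dP] := finite_set_ubound (rdual_support f).
exists (d + k%:R / 2) => n dn; apply: rdual_ext; apply: (direct_sum_ind (pe_direct hgrM)).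
- exact: rdual0r.
- by move=> x y; rewrite !rdualDr => -> ->; rewrite rdual_0E addr0.
move=> j x _ jx; rewrite rdual_0E dual_modeE; apply: contrapT => fx.
have [j0|j0] := ltP j 0.
  apply: fx; rewrite (pe_pos hgrM j0 jx).
  by rewrite (morph0 (opp_modeDr hphi hUps hM v n)) rdual0r.
have : j + n + 1 - k%:R / 2 <= d.
  apply: dP; exists (opp_mode phi Y v n x) => //.
  exact: (opp_mode_gr hphi hGamma hUps hUpsL hUpsphi hM hgrM n gaG gav kv pv jx).
by lra.
Qed.

Lemma gbinom_conj (c : R[i]) j : c^* = c -> (gbinom c j)^* = gbinom c j.
Proof.
move=> cr; rewrite /gbinom fmorph_div /= rmorph_nat rmorph_prod; congr (_ / _).
by apply: eq_bigr => i _; rewrite rmorphB rmorph_nat; congr (_ - _).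
Qed.

(** At x, the mode of a after the mode of b on f is f at the opposite mode of b after that of a: the
    order in [opp_mode_borcherds]. Scalars leave f conjugated, harmlessly, as all of them are
    real. *)
Lemma dual_mode_borcherds p q ga gb a b m n k f :
  Gamma ga -> Gamma gb -> opp_grading Ups (Zcoset ga) a ->
  opp_grading Ups (Zcoset gb) b -> parity p a -> parity q b ->
  Zcoset ga m -> Zcoset gb k ->
  borcherds (fun x : R => x%:C) (@nprod R V) dual_mode p q a b m n k f.
Proof.
rewrite !opp_grading_Zcoset => gaG gbG gaa gbb pa qb gam gbk; rewrite /borcherds.
have D0 v i : dual_mode v i 0 = 0.
  exact: (morph0 (linear_morphD (dual_mode_linearr v i))).
have ev v c : exists N : nat, forall j, (N <= j)%N -> dual_mode v (c + j%:R) f = 0.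
  have [N NP] := dual_mode_field v f; have [J JP] := eventually_natr_ge N c.
  by exists J => j /JP; exact: NP.
have [Na NaP] := ev a m; have [Nb NbP] := ev b k.
have [Nab NabP] := nprod_field a b.
(* [N0] truncates the sums on M^dagger and [N1] is the bound from M; N exceeds both. *)
pose N0 := maxn `|(Nab - n)%R|%N (maxn Na Nb).
have lz j : (N0 <= j)%N -> nprod a (n + j%:Z) b = 0.
  by rewrite geq_max => /andP[Nj _]; apply: NabP; lia.
have rz j : (N0 <= j)%N ->
    (dual_mode a (m + j%:R) f = 0) * (dual_mode b (k + j%:R) f = 0).
  by rewrite !geq_max => /and3P[_ Naj Nbj]; split; [exact: NaP|exact: NbP].
apply: rdual_ext => x.
have [N1 N1P] := opp_mode_borcherds hphi hGamma hUps hUpsL hUpsphi hM n x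
  (GammaN hGamma gaG) (GammaN hGamma gbG) gaa gbb pa qb (ZcosetN gam) (ZcosetN gbk).
pose N := maxn N0 N1.
rewrite (@fsum_nat _ N) => [|j]; last first.
  rewrite geq_max => /andP[/lz -> _].
  by rewrite (morph0 (linear_morphD (dual_mode_linearl _ f))) scaler0.
rewrite [in RHS](@fsum_nat _ N) => [|j]; last first.
  by rewrite geq_max => /andP[/rz j0 _]; rewrite !j0 !D0 scaler0 subr0 scaler0.
have := congr1 f (N1P N (leq_maxr _ _)).
rewrite !(morph_sum (rdualDr f)) !rdual_sumE => E.
have cM (c d : R[i]) : (c * d)^* = c^* * d^* by exact: rmorphM.
have mr : (m%:C)^* = m%:C by exact: conjc_real.
have sr j : ((-1 : R[i]) ^+ j)^* = (-1) ^+ j by rewrite rmorphXn rmorphN1.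
have zr : ((-1 : R[i]) ^ n)^* = (-1) ^ n by rewrite fmorphXz rmorphN1.
transitivity (\sum_(j < N) f (gbinom m%:C j *:
    opp_mode phi Y (nprod a (n + j%:Z) b) (m + k - j%:R) x)).
  by apply: eq_bigr => j _; rewrite rdual_scaleE dual_modeE rdualZr gbinom_conj.
rewrite E; apply: eq_bigr => j _.
rewrite rdual_scaleE rdualZr cM sr gbinom_conj ?rmorph_int //; congr (_ * _).
rewrite rdual_addE rdual_oppE rdual_scaleE !dual_modeE (morphB (rdualDr f)) rdualZr.
by rewrite cM sr zr.
Qed.

Lemma dual_twisted_module :
  twisted_module Gamma (opp_grading Ups) (rdual_par parM) dual_mode.
Proof.
split.
- exact: (rdual_par_direct (tm_parity_direct hM) (pe_super hgrM)).
- exact: dual_mode_linearl.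
- exact: dual_mode_linearr.
- move=> g a n f gG; rewrite opp_grading_Zcoset => gaa gn.
  apply: rdual_ext => x; rewrite dual_modeE.
  rewrite (opp_mode_index hphi hGamma hUps hUpsL hUpsphi hM x (GammaN hGamma gG) gaa).
    exact: rdual0r.
  by rewrite opprK.
- move=> p q a n f pa qf x px; rewrite dual_modeE; apply: qf.
  have := opp_mode_parity hphi hUps hM n pa px.
  by congr (parM _ _); case: (p) => //=; rewrite negbK.
- exact: dual_mode_field.
- move=> n f; apply: rdual_ext => x; rewrite dual_modeE (opp_mode_vac hphi hM).
  by case: ifP => // _; exact: rdual0r.
- move=> p q ga gb a b m n k f; exact: dual_mode_borcherds.
Qed.

(** Makes M^dagger an admissible input for a second dualization: modes lower the degree on M^dagger
    as they do on M, because opposite modes raise it on M. *)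
Lemma dual_positive_energy : positive_energy Gamma (opp_grading Ups)
  (rdual_par parM) dual_mode (@rdual_gr R M grM).
Proof.
have dM := pe_direct hgrM; have dP := tm_parity_direct hM.
split.
- exact: (rdual_gr_super dP (pe_super hgrM)).
- exact: (rdual_gr_direct dM).
- move=> j f j0 jf; apply: rdual_ext => x.
  have c0 := pe_pos hgrM j0 (component_mem dM x I).
  by rewrite (rdual_gr_component dM x jf) c0 rdual0r.
move=> g k a n j f gG; rewrite opp_grading_Zcoset => gaa ka _ jf.
have hom : forall p u, (Ups (Zcoset (- g)) `&` weight k) u -> parity p u ->
    rdual_gr (j - n) (dual_mode u (n + k%:R / 2 - 1) f).
  move=> p u [gu ku] pu i x ij ix; rewrite dual_modeE.
  apply: (jf (i + (n + k%:R / 2 - 1) + 1 - k%:R / 2)).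
    by move=> e; apply: ij; lra.
  exact: (opp_mode_gr hphi hGamma hUps hUpsL hUpsphi hM hgrM _
    (GammaN hGamma gG) gu ku pu ix).
have sub := rdual_gr_subspace grM (j - n).
(* [opp_mode_gr] asks for a definite parity; the even and odd parts of a stay in its graded piece
   and keep its weight. *)
have [Usub /(_ a gaa)[a0 [a1 [p0 p1 g0 g1 aE]]]] := Ups_super hUps (GammaN hGamma gG).
have pw p : weight k (parity_component a p) by exact: weight_parity_component.
have pc0 : parity_component a false = a0.
  by rewrite aE /parity_component (componentD (parity_direct V))
    (component_hom (parity_direct V) I p0) (component_hom (parity_direct V) I p1) addr0.
have pc1 : parity_component a true = a1.
  by rewrite aE /parity_component (componentD (parity_direct V))
    (component_hom (parity_direct V) I p0) (component_hom (parity_direct V) I p1) add0r.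
have w0 : weight k a0 by rewrite -pc0.
have w1 : weight k a1 by rewrite -pc1.
rewrite aE (linear_morphD (dual_mode_linearl _ f)).
exact: (subspaceD sub (hom _ _ (conj g0 w0) p0) (hom _ _ (conj g1 w1) p1)).
Qed.

End Contragredient.

(** * Finite bases and the double dual *)

Section DualBases.
Variables (R : realType) (U : lmodType R[i]) (F : set U).
Implicit Types (u v : U).

Definition spans n (b : 'I_n -> U) : Prop :=
  forall v, F v -> exists c : 'I_n -> R[i], v = \sum_(i < n) c i *: b i.

Definition independent n (b : 'I_n -> U) : Prop :=
  forall c : 'I_n -> R[i], \sum_(i < n) c i *: b i = 0 -> forall i, c i = 0.

(** [finite_dim] provides only a spanning family; a vector with nonzero coefficient in a linear
    relation is discarded, by induction on the length. *)
Lemma finite_dim_basis : finite_dim F ->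
  exists n (b : 'I_n -> U), [/\ forall i, F (b i), spans b & independent b].
Proof.
case=> n [b [Fb sb]]; elim: n b Fb sb => [|n IH] b Fb sb.
  by exists 0%N, b; split=> // c _ [].
have [ib|nib] := pselect (independent b); first by exists n.+1, b.
have [c [c0 [i0 ci0]]] : exists c : 'I_n.+1 -> R[i],
    \sum_(i < n.+1) c i *: b i = 0 /\ exists i, c i != 0.
  apply: contrapT => nc; apply: nib => c c0 i; apply: contrapT => ci.
  by apply: nc; exists c; split=> //; exists i; apply/eqP.
apply: (IH (fun k => b (lift i0 k))) => [k|v /sb[d ->]]; first exact: Fb.
(* Coefficients after replacing b i0 by minus the sum of the (c k / c i0) b k over the other k. *)
exists (fun k => d (lift i0 k) - d i0 / c i0 * c (lift i0 k)).
under [RHS]eq_bigr => k _ do rewrite scalerBl -scalerA.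
rewrite sumrB -scaler_sumr (bigD1_ord i0) //=.
move/eqP: c0; rewrite (bigD1_ord i0) //= addrC addr_eq0 => /eqP ->.
by rewrite scalerN opprK scalerA divfK // addrC.
Qed.

(** Coordinates are chosen vector by vector; independence makes them unique on F, hence linear
    there. *)
Lemma finite_dim_coordinates : Defs.subspace F -> finite_dim F ->
  exists n (b : 'I_n -> U) (l : 'I_n -> U -> R[i]),
  [/\ forall i, F (b i),
      forall v, F v -> v = \sum_(i < n) l i v *: b i &
      forall i c u v, F u -> F v -> l i (c *: u + v) = c * l i u + l i v].
Proof.
move=> sF /finite_dim_basis[n [b [Fb sb ib]]].
have /choice[l lP] : forall v, exists c : 'I_n -> R[i],
    F v -> v = \sum_(i < n) c i *: b i.
  move=> v; have [/sb[c cE]|nv] := pselect (F v); first by exists c.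
  by exists (fun=> 0).
exists n, b, (fun i v => l v i); split=> // i c u v Fu Fv.
apply/eqP; rewrite -subr_eq0; apply/eqP; move: i.
apply: (ib (fun i => l (c *: u + v) i - (c * l u i + l v i))).
under eq_bigr => i _ do rewrite scalerBl scalerDl -scalerA.
rewrite sumrB big_split /= -scaler_sumr -!lP ?subrr //.
exact: subspaceZD.
Qed.

End DualBases.

Section DoubleDual.
Variables (R : realType) (M : lmodType R[i]) (grM : R -> set M).
Hypothesis dM : direct_sum [set: R] grM.
Hypothesis fM : forall j, finite_dim (grM j).
Implicit Types (f g : rdual grM) (x : M).

Local Notation cM := (component [set: R] grM).
Local Notation grD := (@rdual_gr R M grM).

(** [e] consists of the coordinates with respect to [b], conjugated to become conjugate linear and
    extended by zero to the other degrees. *)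
Lemma rdual_basis j : exists n (b : 'I_n -> M) (e : 'I_n -> rdual grM),
  [/\ forall i, grM j (b i), forall i, rdual_gr j (e i) &
      forall x, grM j x -> x = \sum_(i < n) (e i x)^* *: b i].
Proof.
have [n [b [l [bj bE lL]]]] := finite_dim_coordinates (ds_subspace dM I) (fM j).
have cj x : grM j (cM x j) by exact: (component_mem dM).
have lin i : conj_linear (fun x => (l i (cM x j))^* : R[i]^o).
  move=> c x y; rewrite (componentZD dM) lL // rmorphD rmorphM //.
have l0 i : l i 0 = 0.
  have j0 := subspace0 (ds_subspace dM (I : [set: R] j)).
  by have := lL i (-1) 0 0 j0 j0; rewrite scaler0 addr0 mulN1r addNr.
have van i k x : k <> j -> grM k x -> (l i (cM x j))^* = 0.
  move=> kj kx; rewrite (component_neq dM I kx) ?l0 ?rmorph0 //.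
  by apply/eqP => jk; exact: kj.
have /choice[e eE] : forall i, exists f : rdual grM, forall x, f x = (l i (cM x j))^*.
  move=> i; apply: (rdual_exists (lin i)).
  apply: (@sub_finite_set _ _ [set j]); last exact: finite_set1.
  by move=> k [x kx lx]; apply: contrapT => kj; apply: lx; exact: van kx.
exists n, b, e; split=> // [i k x kj kx|x jx]; first by rewrite eE (van i k).
rewrite {1}(bE x jx); apply: eq_bigr => i _.
by rewrite eE conjCK (component_id dM I jx).
Qed.

Lemma rdual_separates x : (forall f, f x = 0) -> x = 0.
Proof.
move=> x0; apply: (component_inj dM) => j; rewrite (component0 dM).
have [n [b [e [_ ej bE]]]] := rdual_basis j.
rewrite (bE (cM x j)); last exact: (component_mem dM).
rewrite big1 // => i _; rewrite -(rdual_gr_component dM x (ej i)) x0.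
by rewrite rmorph0 scale0r.
Qed.

(** Evaluation at x is linear in f, so it must be conjugated to lie in the dual. Its support is
    finite because functionals of degree n see only x_n, nonzero for finitely many n. *)
Lemma bidual_exists x : exists F : rdual grD, forall f, F f = (f x)^*.
Proof.
apply: (@rdual_exists _ _ grD (fun f => (f x)^*)).
  by move=> c f g; rewrite rdual_addE rdual_scaleE rmorphD rmorphM.
have [r ur r0] := component_support dM x.
apply: (@sub_finite_set _ _ [set` r]); last exact: finite_seq.
move=> n [f nf fx] /=; apply: contrapT => /negP nr; apply: fx.
by rewrite (rdual_gr_component dM x nf) r0 // rdual0r rmorph0.
Qed.

Definition bidual x : rdual grD := projT1 (cid (bidual_exists x)).

Lemma bidualE x f : bidual x f = (f x)^*.
Proof. by rewrite /bidual; case: (cid _) => F FE /=; rewrite FE. Qed.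

Lemma bidual_linear : linear bidual.
Proof.
move=> c x y; apply: rdual_ext => f.
rewrite rdual_addE rdual_scaleE !bidualE rdualDr rdualZr.
by rewrite rmorphD rmorphM /= conjCK.
Qed.

Lemma conj_eq0 (z : R[i]) : z^* = 0 -> z = 0.
Proof. by move/eqP; rewrite conjC_eq0 => /eqP. Qed.

Lemma bidual_inj : injective bidual.
Proof.
move=> x y xy; apply/eqP; rewrite -subr_eq0; apply/eqP; apply: rdual_separates => f.
apply: conj_eq0; rewrite -bidualE (morphB (linear_morphD bidual_linear)) xy.
by rewrite subrr rdual_0E.
Qed.

Lemma bidual_surj (F : rdual grD) : exists x, bidual x = F.
Proof.
have bD := linear_morphD bidual_linear.
move: F; apply: (direct_sum_ind (rdual_gr_direct (rdual_gr_direct dM))).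
- by exists 0; exact: (morph0 bD).
- by move=> F G [x <-] [y <-]; exists (x + y); rewrite bD.
move=> j F _ Fj; have [n [b [e [bj ej bE]]]] := rdual_basis j.
(* In degree j, f is the sum of the f(b i) e i, so F f is the sum of the conjugates of f(b i) times
   F(e i), which is the conjugate of f at this vector. *)
exists (\sum_(i < n) F (e i) *: b i); apply: rdual_ext.
apply: (direct_sum_ind (rdual_gr_direct dM)).
- by rewrite !rdual0r.
- by move=> f g ef eg; rewrite !rdualDr ef eg.
move=> k f _ kf; rewrite bidualE.
have [kj|kj] := pselect (k = j); last first.
  rewrite (Fj k) // (kf j) ?rmorph0 //; first by move=> jk; exact: kj.
  apply: subspace_sum => [|i _]; first exact: (ds_subspace dM I).
  by apply: subspaceZ => //; exact: (ds_subspace dM I).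
rewrite {k}kj in kf.
have fE : f = \sum_(i < n) f (b i) *: e i.
  apply: rdual_ext => x; rewrite rdual_sumE (rdual_gr_component dM x kf).
  rewrite [in LHS](bE (cM x j)); last exact: (component_mem dM).
  rewrite (morph_sum (rdualDr f)); apply: eq_bigr => i _.
  by rewrite rdualZr conjCK rdual_scaleE -(rdual_gr_component dM x (ej i)) mulrC.
rewrite [in RHS]fE !(morph_sum (rdualDr _)) rmorph_sum; apply: eq_bigr => i _.
by rewrite !rdualZr rmorphM /= conjCK mulrC.
Qed.

Lemma bidual_bij : bijective bidual.
Proof.
have /choice[h hK] := bidual_surj.
by exists h => // x; apply: bidual_inj; rewrite hK.
Qed.

(** For the converse, a component of x in degree k other than j is killed by every functional, since
    projecting a functional to degree k gives one on which [bidual x] vanishes. *)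
Lemma bidual_gr j x : grM j x <-> rdual_gr j (bidual x).
Proof.
split=> [jx k f kj kf|jx].
  by rewrite bidualE (kf j) ?rmorph0 // => jk; exact: kj.
have x0 k : k <> j -> cM x k = 0.
  move=> kj; apply: rdual_separates => f; have [g [gk <-]] := rdual_gr_proj dM f k.
  by apply: conj_eq0; rewrite -bidualE (jx k).
suff -> : x = cM x j by exact: (component_mem dM).
apply: (component_inj dM) => k; have := component_mem dM x (I : [set: R] j).
move=> /(component_hom dM I) ->; case: eqP => [->//|kj]; exact: x0.
Qed.

Variable parM : bool -> set M.
Hypothesis dP : direct_sum [set: bool] parM.
Hypothesis sP : forall j, super_subspace parM (grM j).

Lemma bidual_par p x : parM p x <-> rdual_par (rdual_par parM) p (bidual x).
Proof.
split=> [px f pf|px]; first by rewrite bidualE pf ?rmorph0 // negbK.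
have x0 : component [set: bool] parM x (~~ p) = 0.
  apply: rdual_separates => f; have [g [gp <-]] := rdual_par_proj dP sP f (~~ p).
  by apply: conj_eq0; rewrite -bidualE px.
suff -> : x = component [set: bool] parM x p by exact: (component_mem dP).
have := component_par_sum dP x; case: p x0 {px} => /= ->; by rewrite ?add0r ?addr0.
Qed.

End DoubleDual.

(** * Taking opposite modes twice *)

Section DoubleOpposite.
Variables (R : realType) (V : conformalVertexAlgebra R) (phi : V -> V).
Hypothesis hphi : conj_involution phi.
Implicit Types v : V.

Lemma L1div_comp s t v : L1div t (L1div s v) = 'C(s + t, s)%:R *: L1div (s + t) v.
Proof.
elim: t => [|t IH]; first by rewrite L1div0 addn0 binn scale1r.
rewrite L1divSE IH LopZ L1divS addnS; move: (L1div (s + t).+1 v) => w.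
rewrite !scalerA; congr (_ *: _).
have t0 : (t.+1%:R : R[i]) != 0 by rewrite pnatr_eq0.
apply: (mulfI t0); rewrite mulVKf // -!natrM; congr (_%:R).
have := mul_bin_down (s + t).+1 s; rewrite /= -addnS addKn => <-.
by rewrite mulnC.
Qed.

(** The expansion of (1 - 1)^q, with the binomial in the shape that [sum_convolution] produces. *)
Lemma sum_alternating_bin q :
  \sum_(j < q.+1) (-1) ^+ j * 'C(j + (q - j), j)%:R = (q == 0%N)%:R :> R[i].
Proof.
have := exprDn (1 : R[i]) (-1) q; rewrite subrr expr0n => ->.
apply: eq_bigr => j _; rewrite expr1n mul1r subnKC ?mulr_natr //.
by rewrite -ltnS.
Qed.

Lemma phi_L1div s v : phi (L1div s v) = L1div s (phi v).
Proof.
elim: s => [|s IH]; first by rewrite !L1div0.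
rewrite !L1divSE (conj_linear_morphZ (phi_conj_linear hphi)) (phi_Lop hphi) IH.
by rewrite fmorphV rmorph_nat.
Qed.

(* [g^2 = 1] and [g L_1 g^(-1) = - L_1]. *)
Lemma ghom_ghom (k : int) p s v :
  ghom phi (k - s%:Z - s%:Z) p (L1div s (ghom phi k p v)) = (-1) ^+ s *: L1div s v.
Proof.
rewrite /ghom phi_L1div (conj_linear_morphZ (phi_conj_linear hphi)) (phi_invol hphi).
rewrite (linear_morphZ (L1div_linear s)) scalerA; congr (_ *: _).
rewrite /phase expi_conj -expiD -expi_pi_nat; congr expi.
by rewrite !intrD !intrN; field.
Qed.

Variables (Gamma : set R) (hGamma : subgroup_with_Z Gamma).
Variables (Ups : set R -> set V) (hUps : graded_mod_Z Gamma Ups).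
Variables (M : lmodType R[i]) (parM : bool -> set M) (Y : V -> R -> M -> M).
Hypothesis hM : twisted_module Gamma Ups parM Y.
Variables (grM : R -> set M) (Yd : V -> R -> rdual grM -> rdual grM).
Hypothesis hYd : contragredient phi Y Yd.
Hypothesis hD : twisted_module Gamma (opp_grading Ups) (rdual_par parM) Yd.

(** Unfolding both dualizations gives terms (-1)^s L1div t (L1div s v) at index n - s - t. For s + t
    = q they add up to (1 - 1)^q times the mode of L1div q v, and only q = 0 remains. *)
Lemma opp_mode_contragredient v n (f : rdual grM) x :
  opp_mode phi Yd v n f x = f (Y v n x).
Proof.
have hUps' := opp_graded_mod_Z hGamma hUps.
have oD := opp_modeDl hphi hUps' hD n f.
move: v; apply: (homogeneous_ind hUps).
- by rewrite (morph0 oD) (Y0l hM) rdual0r.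
- by move=> u v eu ev; rewrite (oD u v) rdual_addE eu ev (YDl hM) rdualDr.
move=> ga k p v _ _ kv pv.
rewrite (opp_mode_weight hphi hD _ _ kv pv) /opp_mode_hw rdual_sumE.
have kg := half_weight_ghom hphi p (weight_half kv).
have pg := parity_ghom hphi k p pv.
pose Z q := Y (L1div q v) (n - q%:R) x.
have Z0 q : (k < q)%N -> Z q = 0.
  by move=> kq; rewrite /Z (L1div_eq0 (weight_half kv)) ?(Y0l hM) //; lia.
transitivity (f (\sum_(s < k.+1) \sum_(t < k.+1)
  ((-1) ^+ s * 'C(s + t, s)%:R) *: Z (s + t)%N)).
  rewrite (morph_sum (rdualDr f)); apply: eq_bigr => s _.
  rewrite hYd (opp_mode_half_weight hphi hUps hM _ _
    (half_weight_L1div s kg) (L1div_parity s pg)).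
  rewrite (ghom_ghom k p s v).
  have wv : half_weight (k%:Z - s%:Z - s%:Z) ((-1) ^+ s *: L1div s v).
    by rewrite -(ghom_ghom k p); apply: (half_weight_ghom hphi); exact: half_weight_L1div.
  have ks : (`|(k%:Z - s%:Z - s%:Z)%R| < k.+1)%N by move: (ltn_ord s); lia.
  rewrite (opp_mode_hw_widen hM _ _ wv ks); congr (f _); apply: eq_bigr => t _.
  rewrite (linear_morphZ (L1div_linear t)) L1div_comp scalerA (YZl hM).
  congr (_ *: Y _ _ _).
  by rewrite natrD !intrD !intrN; ring.
rewrite (@sum_convolution _ _ k.+1 (fun s t => (-1) ^+ s * 'C(s + t, s)%:R)) //.
rewrite (@sum_nat_pick _ k.+1 0
  (fun q => (\sum_(j < q.+1) (-1) ^+ j * 'C(j + (q - j), j)%:R) *: Z q)) //.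
  by rewrite sum_alternating_bin scale1r /Z L1div0 subr0.
by move=> q /negbTE q0; rewrite sum_alternating_bin q0 scale0r.
Qed.

End DoubleOpposite.

(** * The contragredient module and the isomorphism of M with its double dual *)

Theorem theorem3p6 (R : realType) (V : conformalVertexAlgebra R)
  (phi : V -> V) (hphi : conj_involution phi)
  (Gamma : set R) (hGamma : subgroup_with_Z Gamma)
  (Ups : set R -> set V) (hUps : graded_mod_Z Gamma Ups)
  (hUpsL : Ups (Zcoset 0) (cvec V))
  (hUpsphi : forall gamma v, Gamma gamma ->
     Ups (Zcoset gamma) v -> Ups (Zcoset gamma) (phi v))
  (M : lmodType R[i]) (parM : bool -> set M) (Y : V -> R -> M -> M)
  (hM : twisted_module Gamma Ups parM Y)
  (grM : R -> set M) (hgrM : positive_energy Gamma Ups parM Y grM) :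
  (exists Yd : V -> R -> rdual grM -> rdual grM,
     contragredient phi Y Yd /\
     twisted_module Gamma (opp_grading Ups) (rdual_par parM) Yd) /\
  ((forall n : R, 0 <= n -> finite_dim (grM n)) ->
   exists (Yd : V -> R -> rdual grM -> rdual grM)
     (Ydd : V -> R -> rdual (@rdual_gr R M grM) -> rdual (@rdual_gr R M grM))
     (iota : M -> rdual (@rdual_gr R M grM)),
     [/\ contragredient phi Y Yd,
         contragredient phi Yd Ydd,
         twisted_module Gamma (opp_grading (opp_grading Ups))
           (rdual_par (rdual_par parM)) Ydd,
         forall m (m' : rdual grM), iota m m' = (m' m)^* &
         graded_module_iso parM grM Y
           (rdual_par (rdual_par parM)) (@rdual_gr _ _ (@rdual_gr R M grM)) Ydd
           iota]).
Proof.
pose hD := dual_twisted_module hphi hGamma hUps hUpsL hUpsphi hM hgrM.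
pose hgrD := dual_positive_energy hphi hGamma hUps hUpsL hUpsphi hM hgrM.
split.
  exists (dual_mode hphi hGamma hUps hUpsL hUpsphi hM hgrM).
  by split; [exact: dual_modeE|exact: hD].
move=> fM0.
have dM := pe_direct hgrM; have dP := tm_parity_direct hM.
(* The dual basis argument runs over all real degrees; in negative degrees M_j = 0 and the empty
   family spans. *)
have fM j : finite_dim (grM j).
  have [j0|] := ltP j 0; last exact: fM0.
  exists 0%N, (fun=> 0); split=> [i|v jv]; first by have := ltn_ord i; rewrite ltn0.
  exists (fun=> 0).
  by rewrite big_ord0 (pe_pos hgrM j0 jv).
have hUps' := opp_graded_mod_Z hGamma hUps.
have hUpsL' : opp_grading Ups (Zcoset 0) (cvec V).
  by rewrite opp_grading_Zcoset oppr0.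
have hUpsphi' gamma v : Gamma gamma ->
    opp_grading Ups (Zcoset gamma) v -> opp_grading Ups (Zcoset gamma) (phi v).
  by move=> gG; rewrite opp_grading_Zcoset; exact: (hUpsphi _ _ (GammaN hGamma gG)).
exists (dual_mode hphi hGamma hUps hUpsL hUpsphi hM hgrM).
exists (dual_mode hphi hGamma hUps' hUpsL' hUpsphi' hD hgrD).
exists (bidual dM); split.
- exact: dual_modeE.
- exact: dual_modeE.
- exact: (dual_twisted_module hphi hGamma hUps' hUpsL' hUpsphi' hD hgrD).
- exact: bidualE.
split.
- exact: bidual_linear.
- exact: bidual_bij.
- by move=> p m; apply: bidual_par => //; exact: (pe_super hgrM).
- by move=> j m; apply: bidual_gr.
- move=> v n m; apply: rdual_ext => f.
  (* At f both sides are conjugates of values at m: of f at Y v n m, and of the opposite mode of v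
     on M^dagger applied to f. *)
  rewrite dual_modeE !bidualE.
  by rewrite (opp_mode_contragredient hphi hGamma hUps hM (dual_modeE _ _ _ _ _ _ _) hD).
Qed.
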